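(* Let $k\ge 3$ be an integer, let $\lambda\in\mathbb{C}\setminus\{-n/2: n\in\mathbb{N}\}$, and let $\{p_n\}_{n\ge0}$ be the monic orthogonal polynomial sequence corresponding to the sieved ultraspherical polynomials of the second kind $\{B_n^\lambda(\cdot;k)\}_{n\ge0}$, i.e. $$p_{kn+j}(x)=\frac{n!}{2^{kn+j}(\lambda+1)_n}\,B^\lambda_{kn+j}(x;k)\qquad(n\ge 0,\ 0\le j\le k-1).$$ Let $\mathbf{u}$ be the regular functional with respect to which $\{p_n\}_{n\ge0}$ is an OPS, and put $u_n:=\langle \mathbf{u},x^n\rangle$. Then $$\mathbf{D}(\Phi\mathbf{u})=\Psi\mathbf{u},$$ where $\mathbf D$ is the distributional derivative and $$\Phi(x):=(1-x^2)\widehat U_{k-1}(x),\qquad \Psi(x):=-\big(2x\widehat U_{k-1}(x)+k(2\lambda+1)\widehat T_k(x)\big).$$ Moreover, the formal Stieltjes series $S_{\mathbf u}(z):=-\sum_{n\ge0}u_n/z^{n+1}$ satisfies $$\Phi(z)S_{\mathbf u}'(z)=C(z)S_{\mathbf u}(z)+D(z),$$ where $C$ and $D$ are the polynomials $$C(z):=-\big(z\widehat U_{k-1}(z)+2k\lambda\widehat T_k(z)\big),\qquad D(z):=-2u_0\big(\widehat U_{k-1}(z)+k\lambda\widehat T_{k-1}(z)\big).$$ As a consequence, if $\lambda\in\mathbb{C}\setminus\{-n/2:n\in\mathbb{N}_0\}$ then $\{B_n^\lambda(\cdot;k)\}_{n\ge0}$ is a semiclassical OPS of class $k-1$. If $\lambda=0$,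 then $\{B_n^0(\cdot;k)\}_{n\ge0}$ is, up to normalization, the Chebyshev OPS of the second kind, and so a classical OPS.
   Context: $\mathbb{N}=\{1,2,\dots\}$, $\mathbb{N}_0=\mathbb{N}\cup\{0\}$. $(\alpha)_0:=1$ and $(\alpha)_n:=\alpha(\alpha+1)\cdots(\alpha+n-1)$ for $n\ge1$. Chebyshev polynomials: $T_n(\cos\theta)=\cos n\theta$, $U_n(\cos\theta)=\sin((n+1)\theta)/\sin\theta$; monic versions $\widehat T_n:=2^{1-n}T_n$ and $\widehat U_n:=2^{-n}U_n$. Sieved ultraspherical polynomials of the second kind: the polynomials $C_n(x;\beta|q)$ are defined by $C_0(x;\beta|q)=1$, $C_1(x;\beta|q)=2x(1-\beta)/(1-q)$ and, for $n\ge 1$, $2x(1-\beta q^n)C_n=(1-q^{n+1})C_{n+1}+(1-\beta^2q^{n-1})C_{n-1}$, with $|q|<1$. With $\omega_k:=e^{2\pi i/k}$, $B_n^\lambda(x;k):=\lim_{s\to1}C_n(x;s^{\lambda k+1}\omega_k\,|\,s\omega_k)$ (limit over $s\in(0,1)$). Equivalently, the monic polynomials $p_n$ satisfy $p_0=1$, $p_1=x$, $p_{N+1}=xp_N-\gamma_Np_{N-1}$ ($N\ge1$), where $\gamma_{mk}=\frac{m}{4(m+\lambda)}$ for $m\ge1$, $\gamma_{mk+k-1}=\frac{m+1+2\lambda}{4(m+1+\lambda)}$ for $m\ge0$, and $\gamma_N=\frac14$ for all other $N\ge1$. Let $\mathcal P$ be the space of complex polynomials. A linear functional $\mathbf u:\mathcal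 P\to\mathbb C$ is regular (quasi-definite) if there is a sequence $\{p_n\}_{n\ge0}$ with $\deg p_n=n$, $\langle\mathbf u,p_np_m\rangle=0$ for $n\ne m$ and $\langle\mathbf u,p_n^2\rangle\neq0$; then $\{p_n\}$ is an orthogonal polynomial sequence (OPS) with respect to $\mathbf u$ (and $\mathbf u$ is unique up to a nonzero constant factor). For $\phi\in\mathcal P$: $\langle\phi\mathbf u,p\rangle:=\langle\mathbf u,\phi p\rangle$ and $\langle\mathbf D\mathbf u,p\rangle:=-\langle\mathbf u,p'\rangle$. The OPS (and $\mathbf u$) is semiclassical if $\mathbf u$ is regular and $\mathbf D(\Phi\mathbf u)=\Psi\mathbf u$ for some nonzero polynomials $\Phi,\Psi$ with $\deg\Psi\ge1$; its class is the minimum of $\max\{\deg\Phi-2,\deg\Psi-1\}$ over all such pairs $(\Phi,\Psi)$. Classical means semiclassical of class $0$. *)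

(* Defs.v *)
From mathcomp Require Import all_boot all_order all_algebra.
From mathcomp Require Import complex.
From mathcomp Require Import all_classical all_reals all_analysis.
From mathcomp Require Import ring.

Set Implicit Arguments.
Unset Strict Implicit.
Unset Printing Implicit Defensive.

Import Order.TTheory GRing.Theory Num.Theory.
Import numFieldNormedType.Exports.

Local Open Scope classical_set_scope.
Local Open Scope ring_scope.
Local Open Scope complex_scope.

Definition poch (F : nzRingType) (a : F) (n : nat) : F :=
  \prod_(i < n) (a + i%:R).

Fixpoint chebT (F : nzRingType) (n : nat) {struct n} : {poly F} :=
  match n with
  | 0 => 1
  | n'.+1 => match n' with
             | 0 => 'X
             | m.+1 => 2%:R *: ('X * chebT F n') - chebT F m
             end
  end.

Fixpoint chebU (F : nzRingType) (n : nat) {struct n} : {poly F} :=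
  match n with
  | 0 => 1
  | n'.+1 => match n' with
             | 0 => 2%:R *: 'X
             | m.+1 => 2%:R *: ('X * chebU F n') - chebU F m
             end
  end.

Lemma chebT_cos (R : realType) (n : nat) (t : R) :
  (chebT R[i] n).[(cos t)%:C] = (cos (n%:R * t))%:C.
Proof.
suff H m : (chebT R[i] m).[(cos t)%:C] = (cos (m%:R * t))%:C /\
  (chebT R[i] m.+1).[(cos t)%:C] = (cos (m.+1%:R * t))%:C by case: (H n).
elim: m => [|m [IH0 IH1]].
  by split; rewrite /= ?hornerC ?hornerX ?mul0r ?cos0 ?mul1r.
split=> //.
rewrite -[chebT _ m.+2]/(2%:R *: ('X * chebT R[i] m.+1) - chebT R[i] m).
rewrite hornerD hornerN hornerZ hornerM hornerX IH0 IH1.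
rewrite -(rmorph_nat (real_complex R)) -!rmorphM -rmorphB.
congr (_%:C).
have -> : m.+2%:R * t = m.+1%:R * t + t by rewrite -[m.+2%:R]natr1; ring.
have -> : m%:R * t = m.+1%:R * t - t by rewrite -natr1; ring.
rewrite cosB cosD; ring.
Qed.

Lemma chebU_sin (R : realType) (n : nat) (t : R) :
  (chebU R[i] n).[(cos t)%:C] * (sin t)%:C = (sin (n.+1%:R * t))%:C.
Proof.
suff H m : (chebU R[i] m).[(cos t)%:C] * (sin t)%:C = (sin (m.+1%:R * t))%:C /\
  (chebU R[i] m.+1).[(cos t)%:C] * (sin t)%:C = (sin (m.+2%:R * t))%:C
  by case: (H n).
elim: m => [|m [IH0 IH1]].
  split; first by rewrite /= hornerC !mul1r.
  rewrite /= hornerZ hornerX -(rmorph_nat (real_complex R)) -!rmorphM; congr (_%:C).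
  have -> : 2%:R * t = t + t by ring.
  rewrite sinD; ring.
split=> //.
rewrite -[chebU _ m.+2]/(2%:R *: ('X * chebU R[i] m.+1) - chebU R[i] m).
rewrite hornerD hornerN hornerZ hornerM hornerX mulrBl IH0 -!mulrA IH1.
rewrite -(rmorph_nat (real_complex R)).
rewrite -!rmorphM -rmorphB.
congr (_%:C).
have -> : m.+3%:R * t = m.+2%:R * t + t by rewrite -natr1; ring.
have -> : m.+1%:R * t = m.+2%:R * t - t by rewrite -[m.+2%:R]natr1; ring.
rewrite sinB sinD; ring.
Qed.

(* 2 / 2^n stands for 2^(1 - n), so that mchebT is monic for n >= 1 only. *)
Definition mchebT (R : realType) (n : nat) : {poly R[i]} :=
  (2%:R / 2%:R ^+ n) *: chebT R[i] n.

Definition mchebU (R : realType) (n : nat) : {poly R[i]} :=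
  (2%:R ^- n) *: chebU R[i] n.

Definition cexp (R : realType) (z : R[i]) : R[i] :=
  let: x +i* y := z in (expR x)%:C * (cos y +i* sin y).

(* s^z with the real logarithm; only meaningful for s > 0. *)
Definition cpow (R : realType) (s : R) (z : R[i]) : R[i] :=
  cexp (z * (ln s)%:C).

Definition omega (R : realType) (k : nat) : R[i] :=
  cexp (0 +i* (2%:R * pi / k%:R)).

(* C_n(x; beta | q); the recurrence is solved for C_{n+1}, which is legitimate
   since 1 - q^(n+1) is nonzero whenever |q| < 1. *)
Fixpoint qultra (K : fieldType) (beta q : K) (n : nat) {struct n} : {poly K} :=
  match n with
  | 0 => 1
  | n'.+1 =>
    match n' with
    | 0 => (2%:R * (1 - beta) / (1 - q)) *: 'X
    | m.+1 => (1 - q ^+ n'.+1)^-1 *: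
        ((2%:R * (1 - beta * q ^+ n')) *: ('X * qultra beta q n')
         - (1 - beta ^+ 2 * q ^+ m) *: qultra beta q m)
    end
  end.

(* B_n^lambda(x; k), as the left limit at s = 1 of polynomials in x of degree
   at most n, taken coefficient by coefficient; R[i]^o is R[i] with its norm
   topology. *)
Definition sievedB (R : realType) (k : nat) (lambda : R[i]) (n : nat) :
    {poly R[i]} :=
  \poly_(i < n.+1)
    lim (((qultra (cpow s (lambda * k%:R + 1) * omega R k)
                  (s%:C * omega R k) n)`_i : R[i]^o) @[s --> (1 : R)^'-]).

Definition fmul (K : fieldType) (phi : {poly K}) (u : {poly K} -> K) :
    {poly K} -> K :=
  fun p => u (phi * p).

Definition fder (K : fieldType) (u : {poly K} -> K) : {poly K} -> K :=
  fun p => - u p^`().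

Definition is_OPS (K : fieldType) (u : {scalar {poly K}})
    (p : nat -> {poly K}) : Prop :=
  [/\ forall n, size (p n) = n.+1,
      forall n m, n <> m -> u (p n * p m) = 0 &
      forall n, u (p n ^+ 2) != 0].

Definition regular (K : fieldType) (u : {scalar {poly K}}) : Prop :=
  exists p, is_OPS u p.

Definition pearson_pair (K : fieldType) (u : {scalar {poly K}})
    (Phi Psi : {poly K}) : Prop :=
  [/\ Phi != 0, Psi != 0, (1 < size Psi)%N &
      fder (fmul Phi u) =1 fmul Psi u].

(* max (deg Phi - 2) (deg Psi - 1).  Truncated subtraction is harmless: the
   second entry is nonnegative for every Pearson pair. *)
Definition pair_class (K : fieldType) (Phi Psi : {poly K}) : nat :=
  maxn (size Phi - 3) (size Psi - 2).

Definition semiclassical_of_class (K : fieldType) (u : {scalar {poly K}})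
    (s : nat) : Prop :=
  [/\ regular u,
      exists Phi Psi, pearson_pair u Phi Psi /\ pair_class Phi Psi = s &
      forall Phi Psi, pearson_pair u Phi Psi -> (s <= pair_class Phi Psi)%N].

Definition semiclassical_OPS (K : fieldType) (p : nat -> {poly K})
    (s : nat) : Prop :=
  exists u : {scalar {poly K}}, is_OPS u p /\ semiclassical_of_class u s.

Definition classical_OPS (K : fieldType) (p : nat -> {poly K}) : Prop :=
  semiclassical_OPS p 0.

(* Formal series in integer powers of z: f m is the coefficient of z^m.  They
   contain the Laurent series in 1/z, and form a module over the polynomials
   in z with no support condition needed. *)
Definition fseries (K : fieldType) := int -> K.

Definition fs_poly (K : fieldType) (P : {poly K}) : fseries K :=
  fun m => match m with Posz n => P`_n | Negz _ => 0 end.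

Definition fs_add (K : fieldType) (f g : fseries K) : fseries K :=
  fun m => f m + g m.

Definition fs_pmul (K : fieldType) (P : {poly K}) (f : fseries K) : fseries K :=
  fun m => \sum_(i < size P) P`_i * f (m - (i : nat)%:Z).

Definition fs_deriv (K : fieldType) (f : fseries K) : fseries K :=
  fun m => (m + 1)%:~R * f (m + 1).

(* - \sum_n u_n / z^(n+1); recall that Negz n is the integer - (n + 1). *)
Definition stieltjes (K : fieldType) (u : {poly K} -> K) : fseries K :=
  fun m => match m with Posz _ => 0 | Negz n => - u 'X^n end.

(* Main.v *)
From HB Require Import structures.
Require Import Defs.
From mathcomp Require Import all_boot all_order all_algebra.
From mathcomp Require Import complex.
From mathcomp Require Import all_classical all_reals all_analysis.
From mathcomp Require Import ring lra zify.

Import Order.TTheory GRing.Theory Num.Theory.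
Local Open Scope ring_scope.

Set Implicit Arguments.
Unset Strict Implicit.
Unset Printing Implicit Defensive.

(** The argument works with [V_n := U_(n-1)], so that [V_0 = 0], and with the
    functional rather than with a weight.

    Passing to the limit in the recurrence of the [q]-ultraspherical
    polynomials, the quotients [(1 - s^z w) / (1 - s^N w)] tend to 1 when the
    root of unity [w = omega_k^N] is not 1 and to [z / N] when it is.  Hence
    [sievedB] obeys the Chebyshev recurrence except when the new index is a
    multiple of [k] ([sievedB_sieved]).  Solving this recurrence block by block
    gives, for [j < k],
    [B_(mk+j) = V_(j+1) H_(m+1)(T_k) + V_(k-1-j) H_m(T_k)]
    with [H_(m+1)] the Gegenbauer polynomial of degree [m] and parameter
    [lambda + 1] ([sievedE]).

    A functional [u] annihilates all [B_n] with [n > 0] exactly when it is, up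
    to a factor, the functional of the sequence.  Through [sievedE] this says
    that [q |-> u (V_i q(T_k))], for [0 <= i <= k], vanishes except for
    [i = 1], where it is some functional [v], and [i = k - 1], where it is
    [q |-> - v (y q)] ([sliceE]); moreover [v] is the Gegenbauer functional of
    parameter [lambda]: [v ((1 - y^2) q') = (2 lambda + 1) v (y q)]
    ([slice1_pearson]).  Analytically, with [x = cos t], the weight is
    [|sin kt|^(2 lambda) sin^2 t dt], and integrating a trigonometric monomial
    against a function of [kt] kills all frequencies not divisible by [k].
    Since the [V_i q(T_k)] with [0 < i <= k] span all polynomials, the Pearson
    equation need only be tested on them, where it reduces to that of [v]
    ([sieved_pearson_unscaled]).

    In the Stieltjes equation the coefficients of negative powers are the
    Pearson equation tested on monomials.  The others involve only moments of
    order less than [k]; these agree with the moments of the Chebyshev functional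
    of the second kind, so the polynomial part is found by Chebyshev recurrences
    ([dquot_chebT], [dquot_weighted_chebV]).

    For the class, two Pearson pairs of a regular functional satisfy
    [Phi1 (Psi - Phi') = Phi (Psi1 - Phi1')].  Since [Phi] and
    [C = Psi - Phi'] are coprime when [lambda] is neither 0 nor [- 1/2]
    (at the zeros of [U_(k-1)] one has [T_k^2 = 1], and the values at [1] and
    [-1] are explicit), [Phi] divides every other [Phi1] ([class_ge]).  When
    [lambda = 0] the recurrence is that of [U_n] ([sieved_chebU]), whose
    functional has the Pearson pair [(1 - X^2, - 3 X)] of class 0
    ([chebU_pearson]). *)

(** * Chebyshev polynomials *)

(** The shift by one of the second kind, [sin (n t) / sin t] at [cos t]: with
    [chebV F 0 = 0] in place of [U_(-1)] the identities below need no exception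
    at the origin. *)
Definition chebV (F : nzRingType) (n : nat) : {poly F} :=
  if n is m.+1 then chebU F m else 0.

Section Chebyshev.
Variable F : comNzRingType.
Notation T := (chebT F).
Notation V := (chebV F).

Lemma chebTSS n : T n.+2 = 2%:R * 'X * T n.+1 - T n.
Proof. by rewrite -mulrA mulr_natl -scaler_nat. Qed.

Lemma chebVSS n : V n.+2 = 2%:R * 'X * V n.+1 - V n.
Proof.
case: n => [|n]; first by rewrite /= mulr1 subr0 scaler_nat mulr_natl.
by rewrite -mulrA mulr_natl -scaler_nat.
Qed.

Lemma chebT_XV n : T n.+1 = 'X * V n.+1 - V n.
Proof.
suff H m : T m.+1 = 'X * V m.+1 - V m /\ T m.+2 = 'X * V m.+2 - V m.+1 by case: (H n).
elim: m => [|m [IH0 IH1]]; last by split=> //; rewrite chebTSS IH0 IH1 !chebVSS; ring.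
by split; rewrite ?chebTSS ?chebVSS /=; ring.
Qed.

Lemma chebT_VV n : 2%:R * T n.+1 = V n.+2 - V n.
Proof. by rewrite chebT_XV chebVSS; ring. Qed.

Lemma chebT_VX n : T n = V n.+1 - 'X * V n.
Proof. case: n => [|n]; first by rewrite /=; ring. by rewrite chebT_XV chebVSS; ring. Qed.

(** The two derivatives determine each other through [T_n = V_(n+1) - X V_n],
    so both rules are proved in one induction. *)
Lemma deriv_chebT_chebV n : (T n)^`() = n%:R * V n /\
   (1 - 'X ^+ 2) * (V n)^`() = 'X * V n - n%:R * T n.
Proof.
suff H m : ((T m)^`() = m%:R * V m /\
   (1 - 'X ^+ 2) * (V m)^`() = 'X * V m - m%:R * T m) by case: (H n).
elim: m => [|m [IH0 IH1]].
  by rewrite /= !derivC; split; ring.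
have HV : (V m.+1)^`() = V m + 'X * (V m)^`() + (T m)^`().
  by rewrite [T m]chebT_VX derivB derivM derivX; ring.
have HT : (T m.+1)^`() = V m.+1 + 'X * (V m.+1)^`() - (V m)^`().
  by rewrite chebT_XV derivB derivM derivX; ring.
split.
- have -> : (T m.+1)^`() = 'X * V m + V m.+1 + 'X * (T m)^`() - (1 - 'X ^+ 2) * (V m)^`().
    by rewrite HT HV; ring.
  rewrite IH1 IH0 [T m]chebT_VX -addn1 natrD; ring.
- have -> : (1 - 'X ^+ 2) * (V m.+1)^`() =
      (1 - 'X ^+ 2) * (V m + (T m)^`()) + 'X * ((1 - 'X ^+ 2) * (V m)^`()).
    by rewrite HV; ring.
  rewrite IH1 IH0 chebT_XV [T m]chebT_VX -[m.+1%:R]natr1; ring.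
Qed.

(** This is [cos^2 + sin^2 = 1] at the angle [n t]. *)
Lemma chebT_chebV_pell n : T n ^+ 2 + (1 - 'X ^+ 2) * V n ^+ 2 = 1.
Proof.
elim: n => [|n IH]; first by rewrite /=; ring.
rewrite -{}[RHS]IH [T n]chebT_VX chebT_XV; ring.
Qed.

(** Product-to-sum formulas for [2 cos (a t) sin (b t)]; writing the larger
    index as [i + d] keeps all indices natural. *)
Lemma mul_chebT_chebV i d :
  2%:R * T i * V (i + d) = V (i + i + d) + V d /\
  2%:R * T (i + d) * V i = V (i + i + d) - V d.
Proof.
suff H m : forall d, (2%:R * T m * V (m + d) = V (m + m + d) + V d /\
   2%:R * T (m + d) * V m = V (m + m + d) - V d) /\
  (2%:R * T m.+1 * V (m.+1 + d) = V (m.+1 + m.+1 + d) + V d /\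
   2%:R * T (m.+1 + d) * V m.+1 = V (m.+1 + m.+1 + d) - V d) by case: (H i d).
elim: m => [|m IH] {}d; first split; first by rewrite /= !add0n; split; ring.
  split; rewrite !(addSn, add0n) chebVSS.
    rewrite /=; ring.
  by rewrite chebT_XV /=; ring.
split; first by case: (IH d).
have [_ [A1 A2]] := IH d.+1; have [[B1 B2] _] := IH d.+2.
move: A1 A2 B1 B2; rewrite !(addSn, addnS) => A1 A2 B1 B2.
split.
  rewrite chebTSS.
  transitivity (2%:R * 'X * (2%:R * T m.+1 * V (m + d).+2)
    - 2%:R * T m * V (m + d).+2); first by ring.
  by rewrite A1 B1 !chebVSS; ring.
rewrite (chebVSS m).
transitivity (2%:R * 'X * (2%:R * T (m + d).+2 * V m.+1)
  - 2%:R * T (m + d).+2 * V m); first by ring.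
by rewrite A2 B2 !chebVSS; ring.
Qed.

(** The step by two that computes [V_k V_i] modulo the structure given by
    [T_k]: both sides are [2 V_k T_(i+1)]. *)
Lemma mul_chebV_diff k i : (i < k)%N ->
  V k * (V i.+2 - V i) = 2%:R * T k * V i.+1 + 2%:R * V (k - i.+1).
Proof.
move=> lt_ik; rewrite -chebT_VV.
have [] := mul_chebT_chebV i.+1 (k - i.+1); rewrite subnKC // => H1 H2.
transitivity (2%:R * T i.+1 * V k); first by ring.
by rewrite H1 H2; ring.
Qed.

Lemma chebV_at1 n : (V n).[1] = n%:R.
Proof.
suff H m : (V m).[1] = m%:R /\ (V m.+1).[1] = m.+1%:R by case: (H n).
elim: m => [|m [IH0 IH1]]; first by rewrite /= !hornerE.
by split=> //; rewrite chebVSS !hornerE IH0 IH1 /=; ring.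
Qed.

Lemma chebT_at1 n : (T n).[1] = 1.
Proof. by rewrite chebT_VX !hornerE !chebV_at1 -natr1; ring. Qed.

Lemma chebV_atN1 n : (V n).[-1] = - (-1) ^+ n * n%:R.
Proof.
suff H m : (V m).[-1] = - (-1) ^+ m * m%:R /\
  (V m.+1).[-1] = - (-1) ^+ m.+1 * m.+1%:R by case: (H n).
elim: m => [|m [IH0 IH1]]; first by rewrite /= !hornerE; split; ring.
split=> //; rewrite chebVSS !hornerE IH0 IH1 !exprS /=; ring.
Qed.

Lemma chebT_atN1 n : (T n).[-1] = (-1) ^+ n.
Proof. by rewrite chebT_VX !hornerE !chebV_atN1 -natr1 exprS; ring. Qed.

End Chebyshev.

(** * Polynomial sequences with one member in each degree *)

Section Triangular.
Variable K : fieldType.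

Lemma size_three_term (P Q : {poly K}) a b n :
  size P = n.+1 -> a != 0 -> (size Q <= n.+1)%N ->
  size (a *: ('X * P) - b *: Q) = n.+2.
Proof.
move=> sP a0 sQ.
have sXP : size (a *: ('X * P)) = n.+2.
  by rewrite size_scale // mulrC size_mulX ?sP // -size_poly_eq0 sP.
rewrite size_polyDl sXP // size_polyN.
by rewrite (leq_ltn_trans (size_scale_leq _ _)).
Qed.

Lemma lead_split (p : nat -> {poly K}) n (q : {poly K}) :
  (forall n, size (p n) = n.+1) -> (size q <= n.+1)%N ->
  exists c r, [/\ q = c *: p n + r, (size r <= n)%N & (size q = n.+1 -> c != 0)].
Proof.
move=> sp sq.
have lcE : (p n)`_n = lead_coef (p n) by rewrite lead_coefE sp.
have lc0 : (p n)`_n != 0 by rewrite lcE lead_coef_eq0 -size_poly_eq0 sp.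
exists (q`_n / (p n)`_n), (q - (q`_n / (p n)`_n) *: p n); split.
- by rewrite addrC subrK.
- apply/leq_sizeP => j; rewrite leq_eqVlt coefB coefZ => /predU1P[<-|nj].
    by rewrite divfK ?subrr.
  have -> : q`_j = 0 by rewrite nth_default // (leq_trans sq).
  have -> : (p n)`_j = 0 by rewrite nth_default // sp.
  by rewrite mulr0 subr0.
- move=> sqn; rewrite mulf_neq0 ?invr_eq0 //.
  by have := lead_coef_eq0 q; rewrite lead_coefE sqn /= => ->; rewrite -size_poly_eq0 sqn.
Qed.

(** A sequence with one member in each degree is a basis, so it is enough to
    check on it a property that is stable under linear combinations. *)
Lemma triangular_poly_ind (P : nat -> {poly K}) (S : {poly K} -> Prop) :
  (forall n, size (P n) = n.+1) ->
  S 0 -> (forall a p q, S p -> S q -> S (a *: p + q)) ->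
  (forall n, S (P n)) -> forall p, S p.
Proof.
move=> sP S0 SD SP p; have [n] := ubnP (size p).
elim: n p => // n IH p; rewrite ltnS => sp.
case: n => [|n] in IH sp *; first by move: sp; rewrite leqn0 size_poly_eq0 => /eqP ->.
have [c [r [-> sr _]]] := lead_split sP sp.
by apply: SD => //; apply: IH.
Qed.
End Triangular.

(** * Gegenbauer polynomials *)

Section Gegenbauer.
Variables (K : numFieldType) (l : K).

(** The Gegenbauer polynomial [C_(n-1)] of parameter [l + 1]; as for [chebV],
    the shift lets the recurrence start from 0 and 1. *)
Fixpoint gegen (n : nat) {struct n} : {poly K} :=
  match n with
  | 0 => 0
  | n'.+1 => match n' with
             | 0 => 1
             | m.+1 => (n'%:R)^-1 *: ((2%:R * (n'%:R + l)) *: ('X * gegen n')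
                         - (n'%:R + 2%:R * l) *: gegen m)
             end
  end.
Notation H := gegen.

Lemma gegenSS n : n.+1%:R *: H n.+2 =
  (2%:R * (n.+1%:R + l)) *: ('X * H n.+1) - (n.+1%:R + 2%:R * l) *: H n.
Proof. by rewrite [H n.+2]/= scalerA divff ?pnatr_eq0 // scale1r. Qed.

Lemma comp_gegenSS (q : {poly K}) n : n.+1%:R *: (H n.+2 \Po q) =
  (2%:R * (n.+1%:R + l)) *: (q * (H n.+1 \Po q))
    - (n.+1%:R + 2%:R * l) *: (H n \Po q).
Proof.
by rewrite -comp_polyZ gegenSS comp_polyB !comp_polyZ comp_polyM comp_polyX.
Qed.

Lemma size_gegen n : (forall n, n.+1%:R + l != 0) -> size (H n.+1) = n.+1.
Proof.
move=> hl.
suff G m : (size (H m) <= m)%N /\ size (H m.+1) = m.+1 by case: (G n).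
elim: m => [|m [IH0 IH1]]; first by rewrite /= size_poly0 size_poly1.
split; first by rewrite IH1.
rewrite [H m.+2]/= size_scale ?invr_eq0 ?pnatr_eq0 //.
by apply: size_three_term => //; [rewrite mulf_neq0 ?pnatr_eq0|exact: leqW].
Qed.

(** Proved together with [X H_(n+1)' - H_n' = n H_(n+1)]; each of the two rules
    for [n + 1] follows from both rules for [n] and the differentiated
    recurrence. *)
Lemma deriv_gegen n :
  (1 - 'X ^+ 2) * (H n.+1)^`() =
    (n.+1%:R + 2%:R * l) *: H n - n%:R *: ('X * H n.+1).
Proof.
suff [] : (1 - 'X ^+ 2) * (H n.+1)^`() =
    (n.+1%:R + 2%:R * l) *: H n - n%:R *: ('X * H n.+1) /\
   'X * (H n.+1)^`() - (H n)^`() = n%:R *: H n.+1 by [].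
elim: n => [|n [E1 E2]].
  by rewrite /= -polyC1 !derivC; split; rewrite ?scaler0 ?scale0r ?mulr0 ?subr0.
have n0 : n.+1%:R != 0 :> {poly K} by rewrite -polyC_natr polyC_eq0 pnatr_eq0.
have rec := gegenSS n; move: E1 E2 rec.
rewrite -!mul_polyC !(polyC_natr, polyCM, polyCD) => E1 E2 rec.
have E3 : (H n.+2)^`() = 'X * (H n.+1)^`() + (n.+2%:R + 2%:R * l%:P) * H n.+1.
  apply: (mulfI n0); have := congr1 (@deriv _) rec.
  have dn i : (i%:R : {poly K})^`() = 0 by rewrite -polyC_natr derivC.
  rewrite !(derivM, derivB, derivX, derivD, derivC, dn) => /(canRL (addKr _)) ->.
  have -> : (H n)^`() = 'X * (H n.+1)^`() - n%:R * H n.+1 by rewrite -E2; ring.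
  ring.
have E2' : 'X * (H n.+2)^`() - (H n.+1)^`() = n.+1%:R * H n.+2.
  rewrite rec E3.
  have -> : 'X * ('X * (H n.+1)^`() + (n.+2%:R + 2 * l%:P) * H n.+1) - (H n.+1)^`() =
    'X * (n.+2%:R + 2 * l%:P) * H n.+1 - (1 - 'X ^+ 2) * (H n.+1)^`() by ring.
  by rewrite E1; ring.
split=> //.
have -> : (1 - 'X ^+ 2) * (H n.+2)^`() =
    (H n.+2)^`() - 'X * ('X * (H n.+2)^`() - (H n.+1)^`())
      - 'X * (H n.+1)^`() by ring.
rewrite E2' E3; ring.
Qed.
End Gegenbauer.

(** * The recurrence of the sieved polynomials *)

Section Sieved.
Variables (K : numFieldType) (k : nat) (l : K).
Hypothesis k3 : (2 < k)%N.
Notation T := (chebT K).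
Notation V := (chebV K).
Notation H := (gegen l).

(** With [a] equal to [l] and to [2 l] these are the two modified coefficients of
    the recurrence at the index [n = m k], namely [(m + a) / m]. *)
Definition sieve_coef (a : K) (n : nat) : K :=
  if (k %| n)%N then ((n %/ k)%:R + a) / (n %/ k)%:R else 1.

Lemma sieve_coef_neq0 a m : (forall n, n.+1%:R + a != 0) -> sieve_coef a m.+1 != 0.
Proof using k3.
move=> ha; rewrite /sieve_coef; case: ifP => [|_]; last exact: oner_neq0.
move/dvdnP=> [[|q] e]; first by rewrite mul0n in e.
by rewrite e mulnK ?mulf_neq0 ?invr_eq0 ?pnatr_eq0 //; lia.
Qed.

(** The sieved ultraspherical polynomials of the second kind, defined by the limit
    of the recurrence instead of by the limit of its solutions. *)
Fixpoint sieved (n : nat) {struct n} : {poly K} :=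
  match n with
  | 0 => 1
  | n'.+1 => match n' with
             | 0 => 2%:R *: 'X
             | m.+1 => (2%:R * sieve_coef l n'.+1) *: ('X * sieved n')
                         - sieve_coef (2%:R * l) n'.+1 *: sieved m
             end
  end.

Lemma sievedSS n : sieved n.+2 =
  (2%:R * sieve_coef l n.+2) *: ('X * sieved n.+1)
    - sieve_coef (2%:R * l) n.+2 *: sieved n.
Proof. by []. Qed.

(** Within a block of [k] consecutive indices both sides obey the Chebyshev
    recurrence, the second term because [V] does so backwards as well.  At a
    multiple of [k] the modified recurrence turns into the Gegenbauer recurrence in
    the variable [T_k = X V_k - V_(k-1)]. *)
Lemma sievedE m j : (j < k)%N ->
  sieved (m * k + j) =
    V j.+1 * (H m.+1 \Po T k) + V (k - j.+1) * (H m \Po T k).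
Proof.
pose claim m j := sieved (m * k + j) =
    V j.+1 * (H m.+1 \Po T k) + V (k - j.+1) * (H m \Po T k).
have k0 : (0 < k)%N by lia.
(* inside a block neither coefficient is modified *)
have step m' j' : claim m' j' -> claim m' j'.+1 -> (j'.+2 < k)%N -> claim m' j'.+2.
  rewrite /claim !addnS => c0 c1 jk.
  rewrite sievedSS /sieve_coef -!addnS dvdn_addr ?dvdn_mull // gtnNdvd // !addnS c0 c1.
  rewrite chebVSS (_ : k - j'.+1 = (k - j'.+3).+2)%N ?chebVSS; last lia.
  rewrite (_ : k - j'.+2 = (k - j'.+3).+1)%N; last lia.
  rewrite -!mul_polyC; ring.
have two m' : claim m' 0 -> claim m' 1 -> forall j, (j < k)%N -> claim m' j.
  move=> c0 c1 i.
  suff G : ((i < k)%N -> claim m' i) /\ ((i.+1 < k)%N -> claim m' i.+1) by case: G.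
  elim: i => [|i [IH0 IH1]]; first by split.
  by split=> // ik; apply: step => //; [apply: IH0; lia|apply: IH1; lia].
move: j; elim: m => [|m IH] j jk.
  apply: two => //; rewrite /claim mul0n /= comp_poly0 mulr0 addr0 comp_polyC mulr1 //.
(* the first index of a block: the only use of the modified coefficients *)
have c0 : claim m.+1 0.
  have := IH k.-2 ltac:(lia); have := IH k.-1 ltac:(lia).
  rewrite /claim addn0 (_ : m.+1 * k = (m * k + k.-2).+2)%N; last lia.
  rewrite (_ : m * k + k.-1 = (m * k + k.-2).+1)%N; last lia.
  move=> c1 c2; rewrite sievedSS {}c1 {}c2 /sieve_coef.
  rewrite (_ : (m * k + k.-2).+2 = m.+1 * k)%N; last lia.
  rewrite dvdn_mull // mulnK // subn1.
  rewrite (_ : k.-1.+1 = k); last lia.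
  rewrite (_ : k.-2.+1 = k.-1); last lia.
  rewrite (_ : k - k.-1 = 1)%N ?subnn; last lia.
  have Tk : T k = 'X * V k - V k.-1.
    by rewrite -[k in LHS](ltn_predK k0) chebT_XV (ltn_predK k0).
  have m0 : m.+1%:R != 0 :> {poly K} by rewrite -polyC_natr polyC_eq0 pnatr_eq0.
  have m1 : m.+1%:R != 0 :> K by rewrite pnatr_eq0.
  apply: (mulfI m0).
  have := comp_gegenSS l (T k) m.
  move: (H m \Po _) (H m.+1 \Po _) (H m.+2 \Po _) => h0 h1 h2.
  rewrite Tk => rec.
  transitivity (V 1 * (m.+1%:R *: h2) + m.+1%:R * V k.-1 * h1); last first.
    by rewrite -!mul_polyC polyC_natr; ring.
  rewrite rec -!mul_polyC !(polyC_natr, polyCM, polyCD).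
  have mm : (m.+1%:R^-1)%:P * m.+1%:R = 1 :> {poly K} by rewrite -polyC_natr -polyCM mulVf.
  rewrite [V 0]/= [V 1]/=; move: (m.+1%:R^-1)%:P (m.+1%:R : {poly K}) mm => im mp mm.
  ring: mm.
(* here the second term of the recurrence still lies in the previous block *)
have c1 : claim m.+1 1.
  move: c0; have := IH k.-1 ltac:(lia).
  rewrite /claim addn0 addn1 (_ : m.+1 * k = (m * k + k.-1).+1)%N; last lia.
  move=> c1 c0; rewrite sievedSS {}c0 c1 /sieve_coef.
  rewrite (_ : (m * k + k.-1).+2 = m.+1 * k + 1)%N; last lia.
  rewrite dvdn_addr ?dvdn_mull // gtnNdvd //; last lia.
  rewrite (_ : k.-1.+1 = k) ?subnn; last lia.
  move: (H m \Po _) (H m.+1 \Po _) (H m.+2 \Po _) => h0 h1 h2.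
  have [d ->] : exists d, k = d.+2 by exists (k - 2)%N; lia.
  rewrite subn1 subn2 [_.+2.-1]/= [_.+2.-2]/= !chebVSS.
  rewrite -!mul_polyC /=; ring.
exact: two.
Qed.

Lemma size_sieved n : (forall m, m.+1%:R + l != 0) -> size (sieved n) = n.+1.
Proof using k3.
move=> hl.
suff G m : size (sieved m) = m.+1 /\ size (sieved m.+1) = m.+2 by case: (G n).
elim: m => [|m [IH0 IH1]].
  by rewrite /= size_poly1 size_scale ?size_polyX ?pnatr_eq0.
split=> //; rewrite sievedSS; apply: size_three_term => //; last by rewrite IH0.
by rewrite mulf_neq0 ?sieve_coef_neq0 ?pnatr_eq0.
Qed.

End Sieved.

Section LeadCoef.
Variables (K : numFieldType) (k : nat) (l : K).
Hypothesis k3 : (2 < k)%N.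

(** Each step of the recurrence multiplies the leading coefficient by
    [2 * sieve_coef k l n], so the factors [(m + l) / m] accumulate to a quotient
    of a Pochhammer symbol by a factorial. *)
Lemma coef_sieved n : (forall m, (m.+1)%:R + l != 0) ->
  (sieved k l n)`_n = 2%:R ^+ n * poch (l + 1) (n %/ k) / (n %/ k)`!%:R.
Proof.
move=> hl.
have step m : (sieved k l m.+1)`_m.+1 = 2%:R * sieve_coef k l m.+1 * (sieved k l m)`_m.
  case: m => [|m].
    rewrite /= coefZ coefX coef1 /sieve_coef gtnNdvd //; last lia.
    by rewrite !mulr1.
  rewrite sievedSS coefB !coefZ coefXM /=.
  by rewrite [(sieved k l m)`__]nth_default ?size_sieved ?mulr0 ?subr0.
elim: n => [|n IH].
  by rewrite /= coef1 div0n /poch big_ord0 expr0 !mul1r fact0 invr1.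
rewrite step IH divnS; last lia.
rewrite /sieve_coef; case: ifP => kn; last by rewrite add0n mulr1 exprS !mulrA.
have -> : (n.+1 %/ k = (n %/ k).+1)%N by rewrite divnS ?kn //; lia.
rewrite add1n factS /poch big_ord_recr /= natrM exprS.
have f0 : (n %/ k)`!%:R != 0 :> K by rewrite pnatr_eq0 -lt0n fact_gt0.
have m0 : (n %/ k).+1%:R != 0 :> K by rewrite pnatr_eq0.
move: (2 ^+ n) (bigop _ _ _) => a b.
rewrite -natr1 in m0 *.
by field; rewrite f0.
Qed.

End LeadCoef.

(** * The Pearson equation *)

Section Pearson.
Variables (K : numFieldType) (k : nat) (l : K) (u : {scalar {poly K}}).
Hypothesis k3 : (2 < k)%N.
Hypothesis hl : forall n, (0 < n)%N -> l != - (n%:R / 2%:R).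
Hypothesis hu : forall n, u (sieved k l n.+1) = 0.
Notation T := (chebT K).
Notation V := (chebV K).
Notation H := (gegen l).

Lemma natr_add_neq0 n : n.+1%:R + l != 0.
Proof using hl.
have := hl (ltn0Sn n.*2.+1); apply: contraNneq => /(canRL (addKr _)) ->.
rewrite addr0; apply/eqP; congr (- _).
by rewrite -muln2 (_ : (n * 2).+2 = n.+1 * 2)%N ?natrM ?mulfK ?pnatr_eq0 //; lia.
Qed.

Lemma natr_add2_neq0 n : n.+1%:R + 2%:R * l != 0.
Proof using hl.
have := hl (ltn0Sn n); apply: contraNneq => /(canRL (addKr _)); rewrite addr0 => h.
by rewrite -mulNr -h mulrC mulKf ?pnatr_eq0.
Qed.

(** The functional is studied through its restrictions to the modules
    [V_i K[T_k]], which together span all polynomials. *)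
Definition slice i (q : {poly K}) : K := u (V i * (q \Po T k)).

Lemma sliceP i a p q : slice i (a *: p + q) = a * slice i p + slice i q.
Proof. by rewrite /slice comp_polyD comp_polyZ mulrDr -scalerAr linearP. Qed.

Lemma sliceD i p q : slice i (p + q) = slice i p + slice i q.
Proof. by rewrite -[p]scale1r sliceP mul1r scale1r. Qed.
Lemma sliceZ i a p : slice i (a *: p) = a * slice i p.
Proof. by rewrite /slice comp_polyZ -scalerAr linearZ. Qed.
Lemma slice0 i : slice i 0 = 0.
Proof. by rewrite /slice comp_poly0 mulr0 linear0. Qed.
Lemma sliceB i p q : slice i (p - q) = slice i p - slice i q.
Proof. by rewrite sliceD -scaleN1r sliceZ mulN1r. Qed.

(** What it means for [u] to annihilate the sieved polynomials, by [sievedE]. *)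
Lemma slice_gegen_reflect m j : (j < k)%N -> (0 < m + j)%N ->
  slice j.+1 (H m.+1) = - slice (k - j.+1) (H m).
Proof using k3 hu.
move=> jk mj; apply/eqP; rewrite -addr_eq0 /slice -linearD -sievedE //.
by rewrite (_ : m * k + j = (m * k + j).-1.+1)%N ?hu //; nia.
Qed.

Lemma gegen_ind (S : {poly K} -> Prop) :
  S 0 -> (forall a p q, S p -> S q -> S (a *: p + q)) ->
  (forall n, S (H n.+1)) -> forall p, S p.
Proof using hl.
by apply: triangular_poly_ind => n; apply: size_gegen; apply: natr_add_neq0.
Qed.

(** The reflection [i <-> k - i] of [slice_gegen_reflect] lowers the degree of the
    Gegenbauer factor, and it preserves the indices [1 < i < k - 1]; for [i = k]
    the reflected factor is [V_0 = 0]. *)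
Lemma slice_mid i q : (1 < i)%N -> (i <= k)%N -> i != k.-1 -> slice i q = 0.
Proof using k3 hl hu.
move=> i1 ik ik1; elim/gegen_ind: q => [|a p q hp hq|n]; first exact: slice0.
  by rewrite sliceP hp hq mulr0 addr0.
elim: n i i1 ik ik1 => [|n IH] [|i] // i1 ik ik1;
  rewrite slice_gegen_reflect ?slice0 ?oppr0 //; try lia.
have [->|ik'] := eqVneq i.+1 k; first by rewrite subnn /slice mul0r linear0 oppr0.
by rewrite IH ?oppr0 //; lia.
Qed.

(** Two reflections, through [k - 1] and back to 1. *)
Lemma slice1_step n : slice 1 (H n.+2) = slice 1 (H n).
Proof using k3 hu.
rewrite slice_gegen_reflect ?addn0 //; last lia.
have -> : (k - 1 = (k - 2).+1)%N by lia.
rewrite slice_gegen_reflect; [|lia|lia].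
by rewrite (_ : k - _ = 1)%N ?opprK //; lia.
Qed.

Lemma slice1_X n : slice 1 ('X * H n.+1) = slice 1 (H n).
Proof using k3 hl hu.
have := congr1 (slice 1) (gegenSS l n).
rewrite sliceB (sliceZ 1 n.+1%:R) slice1_step !sliceZ => h.
have c0 : 2%:R * (n.+1%:R + l) != 0 by rewrite mulf_neq0 ?natr_add_neq0 ?pnatr_eq0.
apply: (mulfI c0).
move/eqP: h; rewrite eq_sym subr_eq => /eqP ->; ring.
Qed.

Lemma slice_pred q : slice k.-1 q = - slice 1 ('X * q).
Proof using k3 hl hu.
elim/gegen_ind: q => [|a p q hp hq|n]; first by rewrite mulr0 !slice0 oppr0.
  by rewrite mulrDr -scalerAr !sliceP hp hq; ring.
rewrite slice1_X (_ : k.-1 = (k - 2).+1); last lia.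
rewrite slice_gegen_reflect; [|lia|lia].
by rewrite (_ : k - _ = 1)%N //; lia.
Qed.

(** The functional [slice 1] is the Gegenbauer functional of parameter [l]: on the
    basis [H] the derivative rule leaves only [X H_(n+1)] and [H_n], which have
    the same value. *)
Lemma slice1_pearson q :
  slice 1 ((1 - 'X ^+ 2) * q^`()) = (2%:R * l + 1) * slice 1 ('X * q).
Proof using k3 hl hu.
elim/gegen_ind: q => [|a p q hp hq|n].
- by rewrite deriv0 !mulr0 slice0 mulr0.
- by rewrite derivD derivZ !mulrDr -!scalerAr !sliceP hp hq; ring.
- by rewrite deriv_gegen sliceB !sliceZ slice1_X; ring.
Qed.

Lemma sliceE i q : (i <= k)%N ->
  slice i q = (i == 1)%:R * slice 1 q - (i == k.-1)%:R * slice 1 ('X * q).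
Proof using k3 hl hu.
move=> ik; have [->|i1] := eqVneq i 1%N.
  rewrite (_ : (1%N == k.-1) = false) ?mul0r ?subr0 ?mul1r //; lia.
have [->|ik1] := eqVneq i k.-1; first by rewrite slice_pred /=; ring.
rewrite !mul0r subrr; case: i => [|i] in ik i1 ik1 *; first by rewrite /slice mul0r linear0.
by rewrite slice_mid //; lia.
Qed.

(** The Pearson polynomial contains the factor [V_k], so the products [V_k V_i]
    have to be expressed in the modules [V_j K[T_k]].  The recurrence in [i] of
    [mul_chebV_diff] adds nothing until the index [k] is reached. *)
Lemma slice_mulV i q : (i <= k.+1)%N ->
  u (V k * V i * (q \Po T k)) = (i == k)%:R * (2%:R * slice 1 ((1 - 'X ^+ 2) * q)).
Proof using k3 hl hu.
move=> ik.
suff [] : ((i <= k.+1)%N -> u (V k * V i * (q \Po T k)) =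
        (i == k)%:R * (2%:R * slice 1 ((1 - 'X ^+ 2) * q))) /\
    ((i.+1 <= k.+1)%N -> u (V k * V i.+1 * (q \Po T k)) =
        (i.+1 == k)%:R * (2%:R * slice 1 ((1 - 'X ^+ 2) * q))) by move=> h _; exact: h.
elim: i {ik} => [|i [IH0 IH1]].
  split=> _; first by rewrite mulr0 mul0r linear0 (_ : (0%N == k) = false) ?mul0r //; lia.
  rewrite mulr1 -/(slice k q) slice_mid; [|lia|lia|lia].
  by rewrite (_ : (1%N == k) = false) ?mul0r //; lia.
split=> // ik.
have -> : V k * V i.+2 * (q \Po T k) =
    V k * V i * (q \Po T k) + 2%:R *: (V i.+1 * (('X * q) \Po T k))
      + 2%:R *: (V (k - i.+1) * (q \Po T k)).
  rewrite -[LHS](subrK (V k * V i * (q \Po T k))) -mulrBl -mulrBr mul_chebV_diff; last lia.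
  by rewrite comp_polyM comp_polyX -!mul_polyC !polyC_natr; ring.
rewrite !linearD !linearZ -/(slice _ _) -/(slice _ _) IH0; last lia.
rewrite (@sliceE i.+1); last lia.
rewrite (@sliceE (k - i.+1)); last lia.
have -> : (1 - 'X ^+ 2) * q = q - 'X * ('X * q) by ring.
rewrite sliceB.
have -> : (i == k) = false by lia.
have -> : (i.+2 == k) = (i.+1 == k.-1) by lia.
have -> : (k - i.+1 == k.-1)%N = (i.+1 == 1%N) by lia.
have -> : (k - i.+1 == 1)%N = (i.+1 == k.-1) by lia.
by rewrite /=; ring.
Qed.

(** On [V_i q(T_k)] the left-hand side becomes a combination of [V_i r(T_k)],
    [V_k V_(i+1) q(T_k)] and [V_k V_(i-1) q(T_k)], where [r] is the Pearson
    polynomial of the Gegenbauer functional at [q].  All values vanish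
    separately, except for [i = k - 1], where two of them cancel. *)
Lemma sieved_pearson_unscaled P :
  u ((1 - 'X ^+ 2) * V k * P^`()
      - (2%:R * ('X * V k) + (k%:R * (2%:R * l + 1)) *: T k) * P) = 0.
Proof using k3 hl hu.
pose L P := ((1 - 'X ^+ 2) * V k * P^`()
      - (2%:R * ('X * V k) + (k%:R * (2%:R * l + 1)) *: T k) * P).
rewrite -/(L P).
have LP a p q : L (a *: p + q) = a *: L p + L q.
  by rewrite /L derivD derivZ -!mul_polyC; ring.
have L0 : L 0 = 0 by rewrite /L deriv0; ring.
have main i q : (0 < i)%N -> (i <= k)%N -> u (L (V i * (q \Po T k))) = 0.
  case: i => // i _ ik.
  (* the Pearson polynomial of the Gegenbauer functional at q *)
  pose r := (1 - 'X ^+ 2) * q^`() - (2%:R * l + 1) *: ('X * q).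
  have two_L : 2%:R *: L (V i.+1 * (q \Po T k)) =
     (2%:R * k%:R) *: (V i.+1 * (r \Po T k)) - i.+2%:R *: (V k * V i.+2 * (q \Po T k))
      + i%:R *: (V k * V i * (q \Po T k)).
    have [dT _] := deriv_chebT_chebV K k; have [_ dV] := deriv_chebT_chebV K i.+1.
    have TT := chebT_VV K i; have VV := chebVSS K i; have pell := chebT_chebV_pell K k.
    rewrite /L derivM deriv_comp dT /r comp_polyB comp_polyZ !comp_polyM comp_polyX.
    have -> : (1 - 'X ^+ 2) \Po T k = 1 - T k ^+ 2.
      by rewrite comp_polyB expr2 comp_polyM comp_polyX -polyC1 comp_polyC -expr2.
    move: (q \Po T k) (q^`() \Po T k) => q0 q1.
    rewrite -!mul_polyC !(polyC_natr, polyCM, polyCD).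
    transitivity (2%:R * V k * q0 * ((1 - 'X ^+ 2) * (V i.+1)^`())
       + 2%:R * k%:R * V i.+1 * q1 * ((1 - 'X ^+ 2) * V k ^+ 2)
       - 2%:R * ((2%:R * ('X * V k) + k%:R * (2%:R * l%:P + 1) * T k)
           * (V i.+1 * q0))); first by ring.
    rewrite dV (canRL (addKr _) pell).
    transitivity (2%:R * k%:R * V i.+1 * q1 * (- T k ^+ 2 + 1)
      - 2%:R * k%:R * (2%:R * l%:P + 1) * T k * V i.+1 * q0
      - V k * q0 * (i.+1%:R * (2%:R * T i.+1) + 2%:R * 'X * V i.+1)); first by ring.
    by rewrite TT (_ : 2%:R * 'X * V i.+1 = V i.+2 + V i) ?VV; ring.
  have two0 : 2%:R != 0 :> K by rewrite pnatr_eq0.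
  apply: (mulfI two0); rewrite mulr0.
  have <- : u (2%:R *: L (V i.+1 * (q \Po T k))) = 2%:R * u (L (V i.+1 * (q \Po T k))).
    by rewrite linearZ.
  rewrite two_L.
  rewrite linearD linearB !linearZ -/(slice _ _) !slice_mulV; [|lia|lia].
  rewrite (@sliceE i.+1) // /r !sliceB sliceZ slice1_pearson.
  have -> : 'X * ((1 - 'X ^+ 2) * q^`() - (2 * l + 1) *: ('X * q)) =
    (1 - 'X ^+ 2) * ('X * q)^`() - (1 - 'X ^+ 2) * q - (2 * l + 1) *: ('X * ('X * q)).
    by rewrite derivM derivX -!mul_polyC; ring.
  rewrite !sliceB sliceZ slice1_pearson.
  have -> : (i == k) = false by lia.
  have -> : (i.+2 == k) = (i.+1 == k.-1) by lia.
  have [ik1|_] := eqVneq i.+1 k.-1; last by rewrite /=; ring.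
  have -> : k = i.+2 by lia.
  rewrite /=; ring.
elim/(triangular_poly_ind (P := sieved k l)): P => [||a p q hp hq|n].
- by move=> n; apply: size_sieved => //; exact: natr_add_neq0.
- by rewrite L0 linear0.
- by rewrite LP linearP hp hq mulr0 addr0.
rewrite (divn_eq n k) sievedE ?ltn_pmod //; last lia.
rewrite -[X in X + _]scale1r LP linearP main // ?ltn_pmod //; last lia.
have [->|h] := eqVneq (k - (n %% k).+1)%N 0; first by rewrite mul0r L0 linear0 mulr0 addr0.
by rewrite main ?mulr0 ?addr0 //; lia.
Qed.
End Pearson.

(** * Orthogonality and Favard's theorem *)

Section OrthogonalPolynomials.
Variable K : fieldType.
Implicit Types (u : {scalar {poly K}}) (p P : nat -> {poly K}).

(** The coordinate of [q] on [P 0] in the basis [P], found by removing leading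
    terms, for [q] of degree at most [n]. *)
Fixpoint peel (P : nat -> {poly K}) (n : nat) (q : {poly K}) : K :=
  if n is m.+1 then peel P m (q - (q`_n / (P n)`_n) *: P n) else q`_0.

Lemma exists_functional P : (forall n, size (P n) = n.+1) -> P 0 = 1 ->
  exists u, u 1 = 1 /\ forall n, u (P n.+1) = 0.
Proof.
move=> sP P0.
have lc n : (P n)`_n != 0.
  by have := lead_coef_eq0 (P n); rewrite lead_coefE sP /= => ->; rewrite -size_poly_eq0 sP.
have peelP n a q r : peel P n (a *: q + r) = a * peel P n q + peel P n r.
  elim: n q r => [|n IH] q r; first by rewrite /= coefD coefZ.
  rewrite /= -IH; congr peel.
  by rewrite coefD coefZ mulrDl scalerDl scalerBr scalerA mulrA opprD addrACA.
have peelE m (q : {poly K}) : peel P (size q + m) q = peel P (size q) q.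
  elim: m => [|m IH]; first by rewrite addn0.
  by rewrite addnS /= nth_default ?mul0r ?scale0r ?subr0 //; lia.
pose f (q : {poly K}) := peel P (size q) q.
have fE n (q : {poly K}) : (size q <= n)%N -> f q = peel P n q.
  by move=> sq; rewrite -(subnKC sq) peelE.
have fP : scalar f.
  move=> a q r; pose n := maxn (size q) (size r).
  have sn : (size (a *: q + r)%R <= n)%N.
    rewrite (leq_trans (size_polyD _ _)) // geq_max leq_maxr andbT.
    by rewrite (leq_trans (size_scale_leq _ _)) ?leq_maxl.
  by rewrite (fE n) // (fE n q) ?leq_maxl // (fE n r) ?leq_maxr // peelP.
pose u : {scalar {poly K}} := HB.pack f (GRing.isLinear.Build K {poly K} K *%R f fP).
exists u; split; first by rewrite /= /f size_poly1 /= (coef1 _ 1) mul0r scale0r subr0 coef1.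
move=> n; rewrite /= /f sP.
have -> : peel P n.+2 (P n.+1) = peel P n.+1 (P n.+1).
  by rewrite /= [(P n.+1)`_n.+2]nth_default ?sP // mul0r scale0r subr0.
have peel0 m : peel P m 0 = 0.
  by elim: m => [|m IH] /=; rewrite coef0 // mul0r scale0r subr0.
by rewrite /= divff // scale1r subrr peel0.
Qed.

Lemma OPS_orthogonal u p n (q : {poly K}) :
  is_OPS u p -> (size q <= n)%N -> u (q * p n) = 0.
Proof.
case=> sp orth _.
suff G m : forall q : {poly K}, (size q <= m)%N -> (m <= n)%N ->
  u (q * p n) = 0 by move/G; apply.
elim: m => [|m IH] {}q sq mn.
  by move: sq; rewrite leqn0 size_poly_eq0 => /eqP ->; rewrite mul0r linear0.
have [c [r [-> sr _]]] := lead_split sp sq.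
rewrite mulrDl -scalerAl linearP IH ?(ltnW mn) // orth ?mulr0 ?addr0 //.
by move=> mE; move: mn; rewrite mE ltnn.
Qed.

(** If [q] has degree [n], its pairing with the orthogonal polynomial of degree
    [n] is a nonzero multiple of a squared norm. *)
Lemma regular_faithful u q : regular u -> (forall r, u (q * r) = 0) -> q = 0.
Proof.
move=> [p ops] uq; apply/eqP/negPn/negP; rewrite -size_poly_gt0.
case Eq: (size q) => [//|n] _.
have [sp _ nz] := ops; have [c [r [qE sr c0]]] := lead_split sp (eq_leq Eq).
have := uq (p n); rewrite qE mulrDl -scalerAl linearP (OPS_orthogonal ops sr) addr0.
by move/eqP; rewrite mulf_eq0 (negPf (c0 Eq)) -expr2 (negPf (nz n)).
Qed.

(** The recurrence rewrites [X^(j+1) P_(n+1)] through [X^j P_(n+2)] and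
    [X^j P_n].  By induction on the power, [X^j P_n] is annihilated for [j < n],
    and [u (X^n P_n)] is a nonzero multiple of [u (X^(n-1) P_(n-1))]. *)
Lemma favard u P (a c : nat -> K) : u 1 != 0 -> (forall n, u (P n.+1) = 0) ->
  (forall n, size (P n) = n.+1) ->
  P 0 = 1 ->
  (forall n, P n.+2 = a n *: ('X * P n.+1) - c n *: P n) ->
  (forall n, a n != 0) -> (forall n, c n != 0) ->
  is_OPS u P.
Proof.
move=> u1 uP sP P0 rec a0 c0.
have uXP j n : u ('X^(j.+1) * P n.+1) =
    (a n)^-1 * (u ('X^j * P n.+2) + c n * u ('X^j * P n)).
  rewrite rec mulrBr linearB -!scalerAr !linearZ /= subrK mulKf //.
  by rewrite exprSr mulrA.
have lowX j n : (j < n)%N -> u ('X^j * P n) = 0.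
  elim: j n => [|j IH] [|n] // jn; first by rewrite expr0 mul1r uP.
  by rewrite uXP !IH ?mulr0 ?addr0 ?mulr0 // ltnW // ltnW.
have low (q : {poly K}) n : (size q <= n)%N -> u (q * P n) = 0.
  move=> sq; rewrite -[q]coefK poly_def mulr_suml linear_sum big1 // => i _.
  by rewrite -scalerAl linearZ /= lowX ?mulr0 // (leq_trans (ltn_ord i)).
have diag n : u ('X^n * P n) != 0.
  elim: n => [|n IH]; first by rewrite expr0 mul1r P0.
  by rewrite uXP lowX // add0r !mulf_neq0 ?invr_eq0.
split=> // [n m /eqP|n].
  rewrite neq_ltn => /orP[] nm; first by rewrite low // sP.
  by rewrite mulrC low // sP.
have [d [r [XE sr d0]]] := lead_split sP (eq_leq (size_polyXn K n)).
have := diag n; rewrite XE mulrDl -scalerAl linearP low // addr0 mulf_eq0.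
by rewrite expr2; case/norP.
Qed.

Lemma OPS_scale u P (c : nat -> K) : (forall n, c n != 0) -> is_OPS u P ->
  is_OPS u (fun n => c n *: P n).
Proof.
move=> c0 [sP orth nz]; split=> [n|n m nm|n].
- by rewrite size_scale.
- by rewrite -scalerAl -scalerAr !linearZ /= orth // !mulr0.
- by rewrite expr2 -scalerAl -scalerAr !linearZ /= !mulf_neq0 // -expr2.
Qed.

End OrthogonalPolynomials.

(** * The class of a regular functional *)

Section Class.
Variable K : fieldType.
Variable u : {scalar {poly K}}.

(** Computing the derivative of [Phi Phi1 u] in two ways gives a polynomial
    multiple of [u] that vanishes, hence a polynomial that vanishes. *)
Lemma pearson_pairs_proportional Phi Psi Phi1 Psi1 : regular u ->
  fder (fmul Phi u) =1 fmul Psi u -> fder (fmul Phi1 u) =1 fmul Psi1 u ->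
  Phi1 * (Psi - Phi^`()) = Phi * (Psi1 - Phi1^`()).
Proof.
move=> reg h h1; apply/eqP; rewrite -subr_eq0; apply/eqP.
apply: (regular_faithful reg) => r.
have e := h (Phi1 * r); have e1 := h1 (Phi * r); rewrite /fder /fmul in e e1.
transitivity (u (Psi * (Phi1 * r)) - u (Psi1 * (Phi * r))
  + u (Phi * (Phi1 * r)^`()) - u (Phi1 * (Phi * r)^`())).
  by rewrite -!linearB -linearD -linearB; congr (u _); rewrite !derivM; ring.
by rewrite -e -e1; ring.
Qed.

(** By the previous lemma [Phi] divides [Phi1 (Psi - Phi')], and the second
    factor is prime to [Phi]. *)
Lemma class_ge Phi Psi Phi1 Psi1 : regular u ->
  fder (fmul Phi u) =1 fmul Psi u -> coprimep Phi (Psi - Phi^`()) ->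
  pearson_pair u Phi1 Psi1 -> (size Phi - 3 <= pair_class Phi1 Psi1)%N.
Proof.
move=> reg h cop [n0 _ _ h1].
have e := pearson_pairs_proportional reg h h1.
have d : Phi %| Phi1 by rewrite -(Gauss_dvdpl _ cop) e dvdp_mulr.
by rewrite /pair_class leq_max leq_sub2r // dvdp_leq.
Qed.
End Class.

Section Coprime.
Variables (K : numFieldType) (k : nat) (c : K).
Notation T := (chebT K).
Notation V := (chebV K).

(** At a zero of [V_k] the second polynomial is [c T_k], nonzero by the Pell
    identity; at [1] and [-1] it is [k + c] up to sign. *)
Lemma coprimep_pearson : c != 0 -> k%:R + c != 0 ->
  coprimep ((1 - 'X ^+ 2) * V k) ('X * V k + c *: T k).
Proof.
move=> c0 kc0.
have copV : coprimep (V k) ('X * V k + c *: T k).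
  rewrite coprimep_addl_mul coprimepZr //.
  apply/Bezout_coprimepP; exists ((1 - 'X ^+ 2) * V k, T k) => /=.
  have -> : (1 - 'X ^+ 2) * V k * V k + T k * T k = 1.
    by rewrite -[RHS](chebT_chebV_pell K k); ring.
  exact: eqpxx.
rewrite coprimepMl copV andbT.
have -> : 1 - 'X ^+ 2 = (- 1) *: (('X - 1%:P) * ('X - (- 1)%:P)) :> {poly K}.
  by rewrite -mul_polyC !polyCN; ring.
rewrite coprimepZl ?oppr_eq0 ?oner_eq0 // coprimepMl.
rewrite ![coprimep ('X - _) _]coprimep_sym !coprimep_XsubC /root !hornerE.
rewrite chebV_at1 chebT_at1 chebV_atN1 chebT_atN1 mulr1 kc0 /=.
have -> : - 1 * (- (-1) ^+ k * k%:R) + c * (-1) ^+ k = (-1) ^+ k * (k%:R + c) by ring.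
by rewrite mulf_neq0 // signr_eq0.
Qed.
End Coprime.

(** * Formal Stieltjes series *)

Section Stieltjes.
Variable K : fieldType.
Implicit Types (f : {poly K} -> K) (P Q : {poly K}).

Lemma eq_fs_pmul P (f g : fseries K) : f =1 g -> fs_pmul P f =1 fs_pmul P g.
Proof. by move=> fg m; apply: eq_bigr => i _; rewrite fg. Qed.

(** The derivative of the series is again the series of a functional, so one
    description of products with polynomials serves for both. *)
Lemma fs_deriv_stieltjes (u : {scalar {poly K}}) :
  fs_deriv (stieltjes u) =1 stieltjes (fder u).
Proof.
case=> n; rewrite /fs_deriv /=; first by rewrite mulr0.
case: n => [|n]; first by rewrite /fder expr0 derivC linear0 mul0r !oppr0.
rewrite NegzE (_ : - n.+2%:Z + 1 = Negz n); last by rewrite NegzE; lia.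
rewrite /stieltjes /fder derivXn linearMn /= NegzE !opprK.
by rewrite mulrNz mulNr mulrN opprK mulr_natl.
Qed.

Lemma scalar_fder (u : {scalar {poly K}}) : scalar (fder u).
Proof. by move=> a p q; rewrite /fder derivD derivZ linearP opprD mulrN. Qed.

Section LinearForm.
Variable f : {poly K} -> K.
Hypothesis fL : scalar f.

Lemma form0 : f 0 = 0.
Proof. by have := fL (-1) 0 0; rewrite scaler0 addr0 mulN1r addNr. Qed.

Lemma formZ a p : f (a *: p) = a * f p.
Proof. by rewrite -[a *: p]addr0 fL form0 addr0. Qed.

Lemma formD p q : f (p + q) = f p + f q.
Proof. by rewrite -[p]scale1r fL mul1r scale1r. Qed.

Lemma form_sum n (F : 'I_n -> {poly K}) : f (\sum_i F i) = \sum_i f (F i).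
Proof. exact: (big_morph f formD form0). Qed.

Lemma fs_pmul_stieltjes_neg P n :
  fs_pmul P (stieltjes f) (Negz n) = - f (P * 'X^n).
Proof.
rewrite -[P in RHS]coefK poly_def mulr_suml form_sum /fs_pmul -sumrN.
apply: eq_bigr => i _; rewrite -scalerAl formZ -mulrN -exprD addnC.
by rewrite (_ : Negz n - i%:Z = Negz (n + i)) // !NegzE; lia.
Qed.

(** The coefficients of nonnegative powers in [P S] come from the part of [P] of
    higher degree. *)
Lemma fs_pmul_stieltjes_nat P n :
  fs_pmul P (stieltjes f) n%:Z = - f (drop_poly n.+1 P).
Proof.
rewrite -[P in RHS]coefK poly_def linear_sum form_sum /fs_pmul -sumrN.
apply: eq_bigr => i _; rewrite linearZ formZ -mulrN /=; congr (_ * _).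
have [ni|ni] := ltnP n i.
  rewrite (_ : n%:Z - i%:Z = Negz (i - n.+1)); last by rewrite NegzE; lia.
  by rewrite -[X in 'X^X](subnK ni) -['X^(_ + _)]mul1r exprD mulrA mul1r drop_polyMXn_id.
rewrite subzn // drop_poly_eq0 ?form0 ?oppr0 // size_polyXn ltnS //.
Qed.

(** Up to sign the polynomial part of [P] times the Stieltjes series of [f]; it is
    [f] applied in [y] to the divided difference [(P(x) - P(y)) / (x - y)]. *)
Definition dquot P : {poly K} := \poly_(m < size P) f (drop_poly m.+1 P).

Lemma coef_dquot P m : (dquot P)`_m = f (drop_poly m.+1 P).
Proof.
rewrite coef_poly; case: ltnP => // h.
by rewrite drop_poly_eq0 ?form0 // (leq_trans h).
Qed.

Lemma dquotP a P Q : dquot (a *: P + Q) = a *: dquot P + dquot Q.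
Proof. by apply/polyP => m; rewrite coefD coefZ !coef_dquot linearP fL. Qed.

(** This rule turns every three-term recurrence into one for the polynomial
    parts. *)
Lemma dquot_mulX P : dquot ('X * P) = 'X * dquot P + (f P)%:P.
Proof.
apply/polyP => m; rewrite coefD coefXM coefC !coef_dquot.
case: m => [|m]; rewrite ?add0r ?addr0; congr f; apply/polyP => i.
  by rewrite !coef_drop_poly coefXM addn1.
by rewrite !coef_drop_poly coefXM addnS.
Qed.

Lemma dquotC a : dquot a%:P = 0.
Proof.
apply/polyP => m; rewrite coef_dquot drop_poly_eq0 ?form0 ?coef0 // size_polyC.
by case: (a != 0).
Qed.

Lemma dquot0 : dquot 0 = 0.
Proof. by rewrite -[X in dquot X]polyC0 dquotC. Qed.

Lemma dquot1 : dquot 1 = 0.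
Proof. by rewrite -[X in dquot X]polyC1 dquotC. Qed.
End LinearForm.
End Stieltjes.

Section Moments.
Variables (K : numFieldType) (k : nat) (u : {scalar {poly K}}).
Hypothesis k3 : (2 < k)%N.
Notation T := (chebT K).
Notation V := (chebV K).
Hypothesis hV : forall i, (i.+2 <= k)%N -> u (V i.+2) = 0.

Lemma dquot_chebV j : (j <= k)%N -> dquot u (V j.+1) = (2%:R * u 1) *: V j.
Proof using k3 hV.
have uL : scalar u := linearP u.
move=> jk.
suff [] : ((j <= k)%N -> dquot u (V j.+1) = (2%:R * u 1) *: V j) /\
  ((j.+1 <= k)%N -> dquot u (V j.+2) = (2%:R * u 1) *: V j.+1) by move=> h _; exact: h.
elim: j {jk} => [|j [IH0 IH1]].
  split=> _; first by rewrite /= scaler0 dquot1.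
  rewrite chebVSS /= mulr1 subr0 -[X in dquot u X]addr0 mulr_natl -scaler_nat dquotP //.
  rewrite dquot0 // addr0 -[X in dquot u X]mulr1 dquot_mulX // dquot1 // mulr0 add0r.
  by rewrite -!mul_polyC polyCM polyC_natr mulr1.
split=> // jk; rewrite chebVSS.
have -> : 2%:R * 'X * V j.+2 - V j.+1 = 2%:R *: ('X * V j.+2) + (- 1) *: V j.+1 + 0.
  by rewrite -!mul_polyC polyC_natr; ring.
rewrite -addrA !dquotP // dquot0 // dquot_mulX // IH0 ?IH1 ?hV //; try lia.
by rewrite chebVSS -!mul_polyC !(polyC_natr, polyCM, polyCD, polyCN, polyC0); ring.
Qed.

Lemma dquot_chebT : dquot u (T k) = (2%:R * u 1) *: T k.-1.
Proof using k3 hV.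
have [d kd] : exists d, k = d.+2 by exists (k - 2)%N; lia.
have uL : scalar u := linearP u.
have two0 : 2%:R != 0 :> K by rewrite pnatr_eq0.
apply: (scalerI two0).
have -> : 2%:R *: dquot u (T k) = dquot u (2%:R *: T k).
  by rewrite -[X in _ = dquot u X]addr0 dquotP // dquot0 // addr0.
have -> : 2%:R *: T k = (- 1) *: V d.+1 + V k.+1.
  by rewrite scaleN1r addrC kd -chebT_VV scaler_nat mulr_natl.
rewrite dquotP // !dquot_chebV //; last lia.
have -> : V k = V d + 2%:R * T k.-1 by rewrite kd /= chebT_VV addrC subrK.
by rewrite -!mul_polyC !(polyC_natr, polyCM, polyCN); ring.
Qed.

Lemma fder_weighted_chebV j : (j <= k.-1)%N ->
  2%:R * fder u ((1 - 'X ^+ 2) * V j) = - (j == 2)%:R * u 1.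
Proof using k3 hV.
case: j => [|j] jk; first by rewrite mulr0 /fder deriv0 linear0 /=; ring.
rewrite /fder mulrN.
have <- : u (2%:R *: ((1 - 'X ^+ 2) * V j.+1)^`()) = 2%:R * u ((1 - 'X ^+ 2) * V j.+1)^`().
  by rewrite linearZ.
have -> : 2%:R *: ((1 - 'X ^+ 2) * V j.+1)^`() = j%:R *: V j - j.+2%:R *: V j.+2.
  rewrite derivM (deriv_chebT_chebV K j.+1).2 derivB -polyC1 derivC derivXn polyC1.
  rewrite -!mul_polyC !polyC_natr.
  transitivity (- (2%:R * 'X * V j.+1) - j.+1%:R * (2%:R * T j.+1)).
    by rewrite (_ : 'X^(2.-1) = 'X) ?expr1 //; ring.
  by rewrite chebT_VV (_ : 2%:R * 'X * V j.+1 = V j.+2 + V j) ?chebVSS; ring.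
rewrite linearB !linearZ /= hV; last lia.
case: j jk => [|[|j]] jk.
- by rewrite /= linear0; ring.
- by rewrite /=; ring.
- by rewrite hV /=; [ring|lia].
Qed.

(** The functional [fder u] vanishes on [(1 - X^2) V_j] for small [j] other than
    2, and its value at [j = 2] is what turns the recurrence, which starts from
    [u 1] instead of [2 * u 1], into that of the first kind. *)
Lemma dquot_weighted_chebV j : (j < k)%N ->
  dquot (fder u) ((1 - 'X ^+ 2) * V j.+1) = ((j != 0)%N%:R * u 1 + u 1) *: T j.
Proof using k3 hV.
have fL := scalar_fder u.
move=> jk.
pose claim j := dquot (fder u) ((1 - 'X ^+ 2) * V j.+1) =
  ((j != 0)%N%:R * u 1 + u 1) *: T j.
rewrite -/(claim j).
have step i : dquot (fder u) ((1 - 'X ^+ 2) * V i.+2) =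
   2%:R * 'X * dquot (fder u) ((1 - 'X ^+ 2) * V i.+1)
   - dquot (fder u) ((1 - 'X ^+ 2) * V i)
   + (2%:R * fder u ((1 - 'X ^+ 2) * V i.+1))%:P.
  have -> : (1 - 'X ^+ 2) * V i.+2 =
    2%:R *: ('X * ((1 - 'X ^+ 2) * V i.+1)) + ((- 1) *: ((1 - 'X ^+ 2) * V i) + 0).
    by rewrite chebVSS -!mul_polyC polyC_natr polyCN; ring.
  rewrite !dquotP // dquot_mulX // dquot0 //.
  by rewrite -!mul_polyC polyCM polyC_natr polyCN; ring.
have c0 : claim 0.
  rewrite /claim /= mulr1 mul0r add0r.
  have -> : 1 - 'X ^+ 2 = (- 1) *: ('X * ('X * 1)) + 1%:P :> {poly K}.
    by rewrite -mul_polyC polyCN; ring.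
  rewrite dquotP // !dquot_mulX // [1%:P]polyC1 !dquot1 // mulr1 mulr0 add0r addr0.
  by rewrite /fder derivX derivC linear0 -!mul_polyC polyCN; ring.
suff [] : ((j < k)%N -> claim j) /\ ((j.+1 < k)%N -> claim j.+1) by move=> h _; exact: h.
elim: j {jk} => [|j [IH0 IH1]]; split=> // jk; rewrite /claim step.
  rewrite c0 fder_weighted_chebV; last lia.
  by rewrite mulr0 dquot0 // -!mul_polyC /=; ring.
rewrite IH0 ?IH1 ?fder_weighted_chebV; try lia.
rewrite chebTSS -!mul_polyC; move: (u 1) => m; case: j {IH0 IH1 jk} => [|j].
  by rewrite /= !(mul1r, mul0r, add0r, mulN1r, polyCD, polyCN); ring.
rewrite !eqSS (_ : (j.+1 == 0)%N = false) //.
by rewrite !(mul1r, mul0r, oppr0, polyC0); ring.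
Qed.
End Moments.

Section Normalized.
Variables (K : numFieldType) (k : nat) (l : K) (h : K) (u : {scalar {poly K}}).
Hypothesis k3 : (2 < k)%N.
Hypothesis hl : forall n, (0 < n)%N -> l != - (n%:R / 2%:R).
Hypothesis hu : forall n, u (sieved k l n.+1) = 0.
Let Phi : {poly K} := (1 - 'X ^+ 2) * (h *: chebV K k).
Let Psi : {poly K} := - (2%:R *: ('X * (h *: chebV K k))
       + (k%:R * (2%:R * l + 1)) *: (h *: chebT K k)).
Let C : {poly K} := - ('X * (h *: chebV K k) + (2%:R * k%:R * l) *: (h *: chebT K k)).
Let D : {poly K} := - ((2%:R * u 1) *: (h *: chebV K k
       + (k%:R * l) *: ((2%:R * h) *: chebT K k.-1))).

Lemma pearson_coefs : Psi = Phi^`() + C.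
Proof.
have dX : (1 - 'X ^+ 2)^`() = - (2%:R * 'X) :> {poly K}.
  by rewrite derivB -polyC1 derivC derivXn sub0r mulr_natl.
rewrite /Psi /Phi /C derivM derivZ dX -(scalerAr h (1 - 'X ^+ 2)) (deriv_chebT_chebV K k).2.
rewrite -!mul_polyC !(polyC_natr, polyCM, polyCD); ring.
Qed.

(** The Pearson equation with the normalization of the theorem, where [h] is the
    factor that makes [V_k] monic. *)
Lemma sieved_pearson : fder (fmul Phi u) =1 fmul Psi u.
Proof.
move=> P; apply/eqP; rewrite /fder /fmul eqr_oppLR -subr_eq0 opprK; apply/eqP.
rewrite -linearD -[RHS](mulr0 h) -(sieved_pearson_unscaled k3 hl hu P) -[RHS]linearZ.
congr (u _); rewrite /Phi /Psi -!mul_polyC !(polyC_natr, polyCM, polyCD); ring.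
Qed.

(** Below the index [k] the sieved polynomials are the Chebyshev polynomials. *)
Lemma moments_chebV i : (i.+2 <= k)%N -> u (chebV K i.+2) = 0.
Proof.
move=> ik; have := hu i.
have := @sievedE K k l k3 0 i.+1 ik.
by rewrite mul0n add0n /= comp_poly0 mulr0 addr0 -polyC1 comp_polyC mulr1 => ->.
Qed.

Lemma sieved_stieltjes :
  fs_pmul Phi (fs_deriv (stieltjes u)) =1
          fs_add (fs_pmul C (stieltjes u)) (fs_poly D).
Proof.
have uL : scalar u := linearP u.
have fL := scalar_fder u.
move=> m; rewrite (eq_fs_pmul Phi (fs_deriv_stieltjes u)) /fs_add.
case: m => n; last first.
  rewrite !fs_pmul_stieltjes_neg // /fs_poly addr0; congr (- _).
  have := sieved_pearson 'X^n; rewrite /fder /fmul => e.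
  rewrite /fder derivM linearD opprD e addrC -linearB; congr (u _).
  by rewrite pearson_coefs; ring.
rewrite !fs_pmul_stieltjes_nat // -!coef_dquot // /fs_poly -!coefN -coefD.
congr ((_ : {poly K})`_n).
have hV := moments_chebV.
have -> : Phi = h *: ((1 - 'X ^+ 2) * chebV K k.-1.+1) + 0.
  by rewrite addr0 (ltn_predK k3) /Phi -scalerAr.
have -> : C = (- h) *: ('X * chebV K k.-2.+2)
    + ((- h * (2%:R * k%:R * l)) *: chebT K k + 0).
  by rewrite /C (_ : k.-2.+2 = k) -?mul_polyC ?polyCN ?polyCM; [ring|lia].
rewrite !dquotP // !dquot0 // (dquot_weighted_chebV k3 hV); last lia.
rewrite dquot_mulX // (dquot_chebT k3 hV) (dquot_chebV k3 hV); last lia.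
rewrite hV; last lia.
rewrite (_ : (k.-1 != 0)%N); last lia.
rewrite /D [chebT K k.-1]chebT_VX (_ : k.-1.+1 = k); last lia.
rewrite (_ : k.-2.+1 = k.-1); last lia.
rewrite -!mul_polyC !(polyC_natr, polyCM, polyCD, polyCN, polyC0).
rewrite [nat_of_bool true]/=; ring.
Qed.

End Normalized.

(** * The Chebyshev case *)

Section ChebyshevCase.
Variables (K : numFieldType) (k : nat).
Hypothesis k3 : (2 < k)%N.

(** For [l = 0] the modified coefficients are [m / m]. *)
Lemma sieved_chebU n : sieved k (0 : K) n = chebU K n.
Proof using k3.
have c1 (m : nat) : sieve_coef k (0 : K) m.+1 = 1.
  rewrite /sieve_coef; case: ifP => // /dvdnP [[//|j] ->].
  by rewrite mulnK ?addr0 ?divff ?pnatr_eq0 //; lia.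
suff [] : sieved k (0 : K) n = chebU K n /\ sieved k (0 : K) n.+1 = chebU K n.+1 by [].
elim: n => [|n [IH0 IH1]]; first by [].
by split=> //; rewrite sievedSS mulr0 !c1 IH0 IH1 mulr1 scale1r.
Qed.
End ChebyshevCase.

Lemma size_chebU (K : numFieldType) n : size (chebU K n) = n.+1.
Proof.
rewrite -(@sieved_chebU K 3 isT); apply: size_sieved => [|m]; first by [].
by rewrite addr0 pnatr_eq0.
Qed.

(** Tested on [U_n], the equation involves only [U_(n+1)] and [(n - 1) U_(n-1)],
    and the value of the latter is zero for every [n]. *)
Lemma chebU_pearson (K : numFieldType) (u : {scalar {poly K}}) :
  (forall n, u (chebU K n.+1) = 0) ->
  pearson_pair u (1 - 'X ^+ 2) (- 3%:R *: 'X).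
Proof.
move=> hu.
have n3 : - 3%:R != 0 :> K by rewrite oppr_eq0 pnatr_eq0.
have s2 : size (1 - 'X ^+ 2 : {poly K}) = 3.
  by rewrite addrC size_polyDl size_polyN ?size_polyXn ?size_poly1.
split.
- by rewrite -size_poly_eq0 s2.
- by rewrite scaler_eq0 negb_or n3 polyX_eq0.
- by rewrite size_scale // size_polyX.
move=> P; apply/eqP; rewrite /fder /fmul eqr_oppLR -subr_eq0 opprK; apply/eqP.
pose L P : {poly K} := (1 - 'X ^+ 2) * P^`() + - 3%:R *: 'X * P.
rewrite -linearD -/(L P).
move: P; apply: (@triangular_poly_ind _ _ (fun P => u (L P) = 0) (@size_chebU K))
  => [|a p q hp hq|n].
- by rewrite /L deriv0 !mulr0 addr0 linear0.
- have -> : L (a *: p + q) = a *: L p + L q by rewrite /L derivD derivZ -!mul_polyC; ring.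
  by rewrite linearP hp hq mulr0 addr0.
have two0 : 2%:R != 0 :> K by rewrite pnatr_eq0.
apply: (mulfI two0); rewrite mulr0.
have <- : u (2%:R *: L (chebU K n)) = 2%:R * u (L (chebU K n)) by rewrite linearZ.
have -> : 2%:R *: L (chebU K n) = (n%:R - 1) *: chebV K n - n.+3%:R *: chebV K n.+2.
  rewrite /L -/(chebV K n.+1) (deriv_chebT_chebV K n.+1).2.
  rewrite -!mul_polyC !(polyC_natr, polyCN, polyCD).
  transitivity (- (2%:R * (2%:R * 'X * chebV K n.+1))
    - n.+1%:R * (2%:R * chebT K n.+1)); first by ring.
  rewrite chebT_VV (_ : 2%:R * 'X * chebV K n.+1 = chebV K n.+2 + chebV K n).
    by ring.
  by rewrite chebVSS; ring.
rewrite linearB !linearZ /= hu mulr0 subr0.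
by case: n => [|[|n]]; rewrite ?linear0 ?mulr0 ?subrr ?mul0r ?hu ?mulr0.
Qed.

(** * The limit defining the sieved polynomials *)

Section Limit.
Import numFieldNormedType.Exports.
Local Open Scope classical_set_scope.
Local Open Scope ring_scope.
Local Open Scope complex_scope.
Variable R : realType.

Lemma cexpD (z w : R[i]) : cexp (z + w) = cexp z * cexp w.
Proof.
case: z w => [a b] [c d]; rewrite /cexp /= expRD cosD sinD.
apply/eqP; rewrite eq_complex /=; apply/andP; split; apply/eqP; ring.
Qed.

Lemma cexp0 : cexp (0 : R[i]) = 1.
Proof.
apply/eqP; rewrite eq_complex /= expR0 cos0 sin0.
by apply/andP; split; apply/eqP; ring.
Qed.

Lemma cexpMn (z : R[i]) n : cexp z ^+ n = cexp (n%:R * z).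
Proof.
elim: n => [|n IH]; first by rewrite mul0r cexp0.
by rewrite exprS IH -cexpD -[n.+1%:R]natr1; congr cexp; ring.
Qed.

Lemma cpowD (s : R) z w : cpow s (z + w) = cpow s z * cpow s w.
Proof. by rewrite /cpow mulrDl cexpD. Qed.

Lemma cpowMn (s : R) z n : cpow s z ^+ n = cpow s (n%:R * z).
Proof. by rewrite /cpow cexpMn mulrA. Qed.

Lemma cpow_nat (s : R) n : 0 < s -> cpow s n%:R = s%:C ^+ n.
Proof.
move=> s0; have -> : s%:C = cpow s 1.
  rewrite /cpow mul1r /cexp /= cos0 sin0 lnK ?posrE //.
  by apply/eqP; rewrite eq_complex /=; apply/andP; split; apply/eqP; ring.
by rewrite cpowMn mulr1.
Qed.

Lemma omega_expE k n : omega R k ^+ n = cexp (0 +i* (2%:R * pi * n%:R / k%:R)).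
Proof.
rewrite cexpMn -(rmorph_nat (real_complex R)); congr cexp.
by apply/eqP; rewrite eq_complex /=; apply/andP; split; apply/eqP; ring.
Qed.

Lemma omega_expk k : (0 < k)%N -> omega R k ^+ k = 1.
Proof.
move=> k0; rewrite omega_expE mulfK ?pnatr_eq0 -?lt0n // /cexp expR0.
rewrite mulr_natl cos2pi sin2pi.
by apply/eqP; rewrite eq_complex /=; apply/andP; split; apply/eqP; ring.
Qed.

(** For [0 < r < k] the real part of [omega^r] is [1 - 2 sin^2 (pi r / k)], and
    [0 < pi r / k < pi]. *)
Lemma omega_exp_eq1 k n : (0 < k)%N -> (omega R k ^+ n == 1) = (k %| n)%N.
Proof.
move=> k0; apply/idP/idP; last first.
  by move/dvdnP => [q ->]; rewrite mulnC exprM omega_expk // expr1n.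
rewrite {1}(divn_eq n k) exprD mulnC exprM omega_expk // expr1n mul1r.
apply: contraLR; rewrite /dvdn -lt0n => r0.
have rk : (n %% k < k)%N by rewrite ltn_mod.
move: (n %% k)%N r0 rk => r r0 rk.
rewrite omega_expE /cexp expR0 eq_complex /= negb_and; apply/orP; left.
have -> : 2%:R * pi * r%:R / k%:R = (pi * r%:R / k%:R) *+ 2 :> R.
  by rewrite -mulr_natl; ring.
rewrite cos_mulr2n.
set t := pi * _ / _.
have t0 : 0 < sin t.
  apply: sin_gt0_pi; rewrite /t divr_gt0 ?mulr_gt0 ?pi_gt0 ?ltr0n //=.
  by rewrite ltr_pdivrMr ?ltr0n // ltr_pM2l ?pi_gt0 // ltr_nat.
have := cos2Dsin2 t => h.
apply/negP => /eqP e.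
have : 0 < sin t ^+ 2 by rewrite exprn_gt0.
move: e h; move: (cos t) (sin t) => c d.
by rewrite mul0r mul1r subr0 -[c ^+ 2 *+ 2]mulr_natl => e h; lra.
Qed.

Lemma cvg_left_quotient (f : R -> R) (df : R) : is_derive (1 : R) (1 : R) f df ->
  ((f 1 - f s) / (1 - s) @[s --> (1 : R)^'-] --> df).
Proof.
move=> [+ <-]; rewrite /derivable /derive => fd.
(* difference quotients are taken along the punctured neighbourhoods of 0 *)
have sub1 : (s - 1 : R) @[s --> (1 : R)^'-] --> (0 : R)^'.
  move=> A; rewrite /dnbhs /= => -[e /= e0 eA]; rewrite /at_left /within /=.
  exists e => //= s /= se s1; apply: eA => /=; last by rewrite subr_eq0 lt_eqF.
  by rewrite sub0r normrN distrC.
have := cvg_comp _ _ sub1 fd; apply: cvg_trans; apply: near_eq_cvg.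
near=> s => /=.
have s1 : s < 1 by near: s; exact: nbhs_left_lt.
by rewrite scaler1 subrK -[f 1 - f s]opprB -[1 - s in RHS]opprB invrN mulrNN mulrC.
Unshelve. all: by end_near. Qed.

(** The topology on [R[i]] is that of the complex norm; convergence from the left
    is reduced to real and imaginary parts because the calculus of
    [expR], [cos], [sin] and [ln] is real. *)
Lemma cvg_complex (f g : R -> R) (a b : R) :
  f s @[s --> (1 : R)^'-] --> a -> g s @[s --> (1 : R)^'-] --> b ->
  (f s +i* g s : R[i]^o) @[s --> (1 : R)^'-] --> (a +i* b : R[i]^o).
Proof.
move=> fa gb.
have RC (h : R -> R) (c : R) : h s @[s --> (1 : R)^'-] --> c ->
    ((h s)%:C : R[i]^o) @[s --> (1 : R)^'-] --> (c%:C : R[i]^o).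
  move=> hc; apply/cvgrPdist_lt => -[er ei] /=.
  rewrite ltcE /= => /andP[/eqP -> er0].
  move/cvgrPdist_lt : hc => /(_ er er0); apply: filterS => s hs.
  rewrite -rmorphB normc_def /= expr0n addr0 sqrtr_sqr.
  by rewrite ltcR.
have E (x y : R) : x +i* y = x%:C + 'i%C * y%:C by rewrite [LHS]complexE.
rewrite E (_ : (fun s => f s +i* g s) = (fun s => (f s)%:C + 'i%C * (g s)%:C)); last first.
  by apply/funext => s; rewrite E.
by apply: cvgD; [exact: RC|apply: cvgM; [exact: cvg_cst|exact: RC]].
Qed.

(** The derivative of [s^z] at [s = 1] is [z]. *)
Lemma cvg_cpow_quotient (z : R[i]) :
  ((1 - cpow s z) / (1 - s%:C) : R[i]^o) @[s --> (1 : R)^'-] --> (z : R[i]^o).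
Proof.
case: z => a b.
pose E (s : R) := expR (a * ln s).
pose F (s : R) := E s * cos (b * ln s).
pose G (s : R) := E s * sin (b * ln s).
have dL c : is_derive (1 : R) (1 : R) (fun s => c * ln s) c.
  apply: (is_derive_eq (is_deriveZ c (is_derive1_ln (@ltr01 R)))).
  by rewrite invr1 [_ *: _]mulr1.
have dE : is_derive (1 : R) (1 : R) E a.
  apply: (is_derive_eq (is_derive1_comp (is_derive_expR _) (dL a))).
  by rewrite ln1 mulr0 expR0 mul1r.
have dF : is_derive (1 : R) (1 : R) F a.
  apply: (is_derive_eq (is_deriveM dE (is_derive1_comp (is_derive_cos _) (dL b)))).
  rewrite /E /= ln1 !mulr0 expR0 cos0 sin0.
  by rewrite oppr0 mul0r scaler0 add0r scale1r.
have dG : is_derive (1 : R) (1 : R) G b.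
  apply: (is_derive_eq (is_deriveM dE (is_derive1_comp (is_derive_sin _) (dL b)))).
  rewrite /E /= ln1 !mulr0 expR0 cos0 sin0.
  by rewrite scale0r addr0 scale1r mul1r.
have := cvg_complex (cvg_left_quotient dF) (cvg_left_quotient dG).
apply: cvg_trans; apply: near_eq_cvg; near=> s => /=.
rewrite /cpow /cexp /F /G /E ln1 !mulr0 cos0 sin0 expR0 mulr0 mulr1.
rewrite -(rmorph1 (real_complex R)) -rmorphB -fmorphV /= mulr0 subr0 (mulr0 a) add0r.
apply/eqP; rewrite eq_complex /= !mulr0 !mul0r !subr0 !addr0 ?add0r.
by rewrite !eqxx.
Unshelve. all: by end_near. Qed.

(** For [w = 1] this is the quotient of two difference quotients of powers at
    [s = 1]; otherwise numerator and denominator both tend to [1 - w], which is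
    not zero. *)
Lemma cvg_sieve_ratio (z : R[i]) N (w : R[i]) : (0 < N)%N ->
  ((1 - cpow s z * w) / (1 - s%:C ^+ N * w) : R[i]^o) @[s --> (1 : R)^'-] -->
    ((if w == 1 then z / N%:R else 1) : R[i]^o).
Proof.
move=> N0; have FF : Filter ((1 : R)^'-) by exact: _.
have cst (c : R[i]) : ((c : R[i]^o) @[s --> (1 : R)^'-] --> (c : R[i]^o)) by exact: cvg_cst.
have C1 (z' : R[i]) : (cpow s z' : R[i]^o) @[s --> (1 : R)^'-] --> (1 : R[i]^o).
  have sC : ((1 - s%:C : R[i]^o) @[s --> (1 : R)^'-] --> (0 : R[i]^o)).
    have -> : (0 : R[i]^o) = (0 : R) +i* 0 by [].
    have cs : (1 - s) @[s --> (1 : R)^'-] --> (0 : R).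
      rewrite -[0](subrr (1 : R)); apply: cvgB; first exact: cvg_cst.
      by apply: cvg_at_left_filter; exact: cvg_id.
    have c0 : (0 : R) @[s --> (1 : R)^'-] --> (0 : R) by exact: cvg_cst.
    have := cvg_complex cs c0; apply: cvg_trans.
    apply: near_eq_cvg; near=> s => /=.
    by apply/eqP; rewrite eq_complex /= subr0 !eqxx.
  have := @cvgM _ _ _ FF _ _ _ _ (@cvg_cpow_quotient z') sC; rewrite mulr0 => h.
  have -> : (1 : R[i]^o) = 1 - 0 by rewrite subr0.
  have := @cvgB _ _ _ _ FF _ _ _ _ (cst 1) h; apply: cvg_trans.
  apply: near_eq_cvg; near=> s => /=.
  have s1 : s < 1 by near: s; exact: nbhs_left_lt.
  change (1 - (1 - cpow s z') / (1 - s%:C) * (1 - s%:C) = cpow s z' :> R[i]).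
  rewrite divfK ?subKr // subr_eq0; apply/eqP => /(congr1 (@complex.Re R)) /= e.
  by rewrite -e ltxx in s1.
have SN : \forall s \near (1 : R)^'-, s%:C ^+ N = cpow s N%:R :> R[i].
  by near=> s; rewrite cpow_nat //; near: s; exact: nbhs_left_gt.
have [->|w1] := eqVneq w 1.
  have := @cvgM _ _ _ FF _ _ _ _ (@cvg_cpow_quotient z)
    (@cvgV _ _ _ FF _ _ _ (@cvg_cpow_quotient N%:R)).
  move=> /(_ _); rewrite pnatr_eq0 -lt0n => /(_ N0); apply: cvg_trans.
  apply: near_eq_cvg; near=> s => /=.
  have s1 : s < 1 by near: s; exact: nbhs_left_lt.
  change ((1 - cpow s z) / (1 - s%:C) * ((1 - cpow s N%:R) / (1 - s%:C))^-1
    = (1 - cpow s z * 1) / (1 - s%:C ^+ N * 1) :> R[i]).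
  rewrite !mulr1 (near SN) //.
  have s0 : 1 - s%:C != 0 :> R[i].
    rewrite subr_eq0; apply/eqP => /(congr1 (@complex.Re R)) /= e.
    by rewrite -e ltxx in s1.
  by rewrite invfM invrK mulrACA mulVf ?mulr1 // mulrC.
have nz : 1 - 1 * w != 0 by rewrite mul1r subr_eq0 eq_sym.
have := @cvgM _ _ _ FF _ _ _ _
  (@cvgB _ _ _ _ FF _ _ _ _ (cst 1) (@cvgM _ _ _ FF _ _ _ _ (C1 z) (cst w)))
  (@cvgV _ _ _ FF _ _ nz
    (@cvgB _ _ _ _ FF _ _ _ _ (cst 1) (@cvgM _ _ _ FF _ _ _ _ (C1 N%:R) (cst w)))).
rewrite divff //; apply: cvg_trans; apply: near_eq_cvg; near=> s => /=.
change ((1 - cpow s z * w) / (1 - cpow s N%:R * w)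
  = (1 - cpow s z * w) / (1 - s%:C ^+ N * w) :> R[i]).
by rewrite (near SN).
Unshelve. all: by end_near. Qed.
End Limit.

Section SievedLimit.
Import numFieldNormedType.Exports.
Local Open Scope classical_set_scope.
Local Open Scope ring_scope.
Local Open Scope complex_scope.
Variables (R : realType) (k : nat) (lambda : R[i]).
Hypothesis k3 : (2 < k)%N.
Let beta (s : R) := cpow s (lambda * k%:R + 1) * omega R k.
Let q (s : R) := s%:C * omega R k.

(** With [z = a k + N] and [N = m k] the limit [z / N] of [cvg_sieve_ratio] is
    [(m + a) / m]. *)
Lemma cvg_sieve_coef (a z : R[i]) N : (0 < N)%N -> z = a * k%:R + N%:R ->
  ((1 - cpow s z * omega R k ^+ N) / (1 - q s ^+ N) : R[i]^o) @[s --> (1 : R)^'-] -->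
    (sieve_coef k a N : R[i]^o).
Proof.
move=> N0 ->.
have -> : sieve_coef k a N = if omega R k ^+ N == 1 then (a * k%:R + N%:R) / N%:R else 1.
  rewrite omega_exp_eq1 /sieve_coef; last lia.
  case: ifP => // /dvdnP [m mE]; move: N0; rewrite mE muln_gt0 => /andP[m0 k0].
  rewrite mulnK // natrM -mulrDl invfM mulrACA divff ?mulr1 ?pnatr_eq0 -?lt0n //.
  by rewrite addrC.
have := @cvg_sieve_ratio R (a * k%:R + N%:R) N (omega R k ^+ N) N0.
by under [X in X @ _]eq_fun do rewrite -exprMn.
Qed.

(** Divided by [1 - q^(n+1)], the recurrence of the [q]-ultraspherical polynomials
    has convergent coefficients, although [1 - q^(n+1)] may tend to zero. *)
Lemma cvg_qultra n i :
  ((qultra (beta s) (q s) n)`_i : R[i]^o) @[s --> (1 : R)^'-] -->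
    ((sieved k lambda n)`_i : R[i]^o).
Proof.
have FF : Filter ((1 : R)^'-) by exact: _.
have cst (c : R[i]) : ((c : R[i]^o) @[s --> (1 : R)^'-] --> (c : R[i]^o)) by exact: cvg_cst.
pose claim n := forall i,
  ((qultra (beta s) (q s) n)`_i : R[i]^o) @[s --> (1 : R)^'-] -->
    ((sieved k lambda n)`_i : R[i]^o).
suff [+ _] : claim n /\ claim n.+1 by exact.
elim: n {i} => [|n [IH0 IH1]].
  split=> i; first exact: cst.
  have e1 : sieve_coef k lambda 1 = 1 by rewrite /sieve_coef gtnNdvd //; lia.
  have h := @cvg_sieve_coef lambda (lambda * k%:R + 1) 1 isT erefl.
  rewrite e1 in h; have := @cvgM _ _ _ FF _ _ _ _ (cst (2%:R * ('X : {poly R[i]})`_i)) h.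
  rewrite mulr1 -coefZ; apply: cvg_trans; apply: near_eq_cvg; near=> s.
  change ((2%:R *: ('X : {poly R[i]}))`_i * ((1 - beta s) / (1 - q s))
    = (qultra (beta s) (q s) 1)`_i).
  by rewrite /= !coefZ; ring.
split; first exact: IH1.
move=> i; rewrite sievedSS coefB !coefZ coefXM.
have cX : ((if i == 0%N then 0 else (qultra (beta s) (q s) n.+1)`_i.-1) : R[i]^o)
    @[s --> (1 : R)^'-] -->
    ((if i == 0%N then 0 else (sieved k lambda n.+1)`_i.-1) : R[i]^o).
  by case: eqP => _; [exact: cst|exact: IH1].
have hA := @cvg_sieve_coef lambda (lambda * k%:R + n.+2%:R) n.+2 isT erefl.
have hC := @cvg_sieve_coef (2%:R * lambda) (2%:R * lambda * k%:R + n.+2%:R) n.+2 isT erefl.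
have := @cvgB _ _ _ _ FF _ _ _ _
  (@cvgM _ _ _ FF _ _ _ _ (@cvgM _ _ _ FF _ _ _ _ (cst 2%:R) hA) cX)
  (@cvgM _ _ _ FF _ _ _ _ hC (IH0 i)).
apply: cvg_trans; apply: near_eq_cvg; near=> s.
have s0 : 0 < s by near: s; exact: nbhs_left_gt.
(* beta q^(N-1) and beta^2 q^(N-2), for N = n + 2, as a power of s times omega^N *)
have hbq : cpow s (lambda * k%:R + n.+2%:R) * omega R k ^+ n.+2 = beta s * q s ^+ n.+1.
  rewrite /beta /q [(s%:C * _) ^+ _]exprMn.
  rewrite (_ : lambda * k%:R + n.+2%:R = (lambda * k%:R + 1) + n.+1%:R).
    rewrite cpowD cpow_nat //.
    move: (cpow _ _) (s%:C ^+ _) (omega R k) => x y w; rewrite !exprS; ring.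
  by rewrite -[n.+2%:R]natr1; ring.
have hbbq : cpow s (2%:R * lambda * k%:R + n.+2%:R) * omega R k ^+ n.+2 =
    beta s ^+ 2 * q s ^+ n.
  rewrite /beta /q [(s%:C * _) ^+ _]exprMn [(cpow _ _ * _) ^+ _]exprMn cpowMn.
  rewrite (_ : 2%:R * lambda * k%:R + n.+2%:R = 2%:R * (lambda * k%:R + 1) + n%:R).
    rewrite cpowD cpow_nat //.
    move: (cpow _ _) (s%:C ^+ _) (omega R k) => x y w; rewrite !exprS; ring.
  by rewrite -[n.+2%:R]natr1 -[n.+1%:R]natr1; ring.
change (2%:R * ((1 - cpow s (lambda * k%:R + n.+2%:R) * omega R k ^+ n.+2)
     / (1 - q s ^+ n.+2))
   * (if i == 0%N then 0 else (qultra (beta s) (q s) n.+1)`_i.-1)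
  - (1 - cpow s (2%:R * lambda * k%:R + n.+2%:R) * omega R k ^+ n.+2) / (1 - q s ^+ n.+2)
   * (qultra (beta s) (q s) n)`_i = (qultra (beta s) (q s) n.+2)`_i).
rewrite hbq hbbq.
transitivity (((1 - q s ^+ n.+2)^-1 *:
        ((2%:R * (1 - beta s * q s ^+ n.+1)) *: ('X * qultra (beta s) (q s) n.+1)
         - (1 - beta s ^+ 2 * q s ^+ n) *: qultra (beta s) (q s) n))`_i) => //.
rewrite coefZ coefB !coefZ coefXM.
move: (if _ then _ else _) (qultra _ _ n)`_i => x y; ring.
Unshelve. all: by end_near. Qed.

Lemma sievedB_sieved n : (forall m, m.+1%:R + lambda != 0) ->
  sievedB k lambda n = sieved k lambda n.
Proof.
move=> hl; apply/polyP => i; rewrite coef_poly; case: ltnP => [_|ni].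
  exact: (cvg_lim (@norm_hausdorff R[i] R[i]^o) (@cvg_qultra n i)).
by rewrite nth_default // size_sieved.
Qed.
End SievedLimit.

(** * The theorem *)

Lemma sieved_OPS (K : numFieldType) k (l : K) (u : {scalar {poly K}}) : (2 < k)%N ->
  (forall n, (0 < n)%N -> l != - (n%:R / 2%:R)) ->
  u 1 != 0 -> (forall n, u (sieved k l n.+1) = 0) -> is_OPS u (sieved k l).
Proof.
move=> k3 hl u1 hu; have hl1 := natr_add_neq0 hl.
apply: (@favard _ u _ (fun n => 2%:R * sieve_coef k l n.+2)
  (fun n => sieve_coef k (2%:R * l) n.+2)) => // n.
- exact: size_sieved.
- by rewrite mulf_neq0 ?pnatr_eq0 ?sieve_coef_neq0.
- by rewrite sieve_coef_neq0 // => m; exact: natr_add2_neq0.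
Qed.

Theorem theorem4p1 (R : realType) (k : nat) (lambda : R[i])
  (p : nat -> {poly R[i]})
  (hk : (3 <= k)%N)
  (hlambda : forall n : nat, (0 < n)%N -> lambda != - (n%:R / 2%:R))
  (hp : forall n j : nat, (j < k)%N ->
     p (k * n + j)%N =
       (n`!%:R / (2%:R ^+ (k * n + j) * poch (lambda + 1) n))
         *: sievedB k lambda (k * n + j)) :
  let Phi : {poly R[i]} := (1 - 'X ^+ 2) * mchebU R k.-1 in
  let Psi : {poly R[i]} :=
    - (2%:R *: ('X * mchebU R k.-1)
       + (k%:R * (2%:R * lambda + 1)) *: mchebT R k) in
  let C : {poly R[i]} :=
    - ('X * mchebU R k.-1 + (2%:R * k%:R * lambda) *: mchebT R k) in
  let D (u : {scalar {poly R[i]}}) : {poly R[i]} :=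
    - ((2%:R * u 1)
         *: (mchebU R k.-1 + (k%:R * lambda) *: mchebT R k.-1)) in
  [/\ (forall n, p n \is monic) /\
        (exists u : {scalar {poly R[i]}}, is_OPS u p),
      forall u : {scalar {poly R[i]}}, is_OPS u p ->
        fder (fmul Phi u) =1 fmul Psi u /\
        fs_pmul Phi (fs_deriv (stieltjes u)) =1
          fs_add (fs_pmul C (stieltjes u)) (fs_poly (D u)),
      (forall n : nat, lambda != - (n%:R / 2%:R)) ->
        semiclassical_OPS (sievedB k lambda) k.-1 &
      lambda = 0 ->
        (exists c : nat -> R[i], forall n,
           c n != 0 /\ sievedB k lambda n = c n *: chebU R[i] n) /\
        classical_OPS (sievedB k lambda)].
Proof.
move=> Phi Psi C D.
have k0 : (0 < k)%N by lia.
have hl1 := natr_add_neq0 hlambda.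
have sB n : sievedB k lambda n = sieved k lambda n by apply: sievedB_sieved.
pose h : R[i] := 2%:R ^- k.-1.
have two0 n : 2%:R ^+ n != 0 :> R[i] by rewrite expf_neq0 ?pnatr_eq0.
have h0 : h != 0 by rewrite invr_eq0.
have UE : mchebU R k.-1 = h *: chebV R[i] k.
  by rewrite /mchebU -[k in chebV _ k](ltn_predK hk).
have TE : mchebT R k = h *: chebT R[i] k.
  rewrite /mchebT -[k in 2 ^+ k](ltn_predK hk) exprS invfM mulrA divff ?mul1r //.
have T1E : mchebT R k.-1 = (2%:R * h) *: chebT R[i] k.-1 by [].
(* the reciprocal of the leading coefficient, by coef_sieved *)
pose a n : R[i] := (n %/ k)`!%:R / (2%:R ^+ n * poch (lambda + 1) (n %/ k)).
have a0 n : a n != 0.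
  rewrite mulf_neq0 ?invr_eq0 ?mulf_neq0 ?pnatr_eq0 -?lt0n ?fact_gt0 //.
  by apply/prodf_neq0 => i _; rewrite -addrA nat1r addrC.
have pE n : p n = a n *: sieved k lambda n.
  have := hp (n %/ k)%N (n %% k)%N; rewrite ltn_mod => /(_ k0).
  by rewrite mulnC -divn_eq sB.
have pF : p = fun n => a n *: sieved k lambda n by apply/funext.
have [u0 [u01 u0s]] := exists_functional (fun n => @size_sieved _ k lambda hk n hl1) erefl.
have u0nz : u0 1 != 0 by rewrite u01 oner_neq0.
have ops0 : is_OPS u0 (sieved k lambda) by apply: sieved_OPS.
have sBF : sievedB k lambda = sieved k lambda by apply/funext.
have pearson (u : {scalar {poly R[i]}}) : (forall n, u (sieved k lambda n.+1) = 0) ->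
    fder (fmul Phi u) =1 fmul Psi u.
  move=> us; rewrite /Phi /Psi UE TE; exact: (@sieved_pearson _ k lambda h u hk hlambda us).
split.
- split; last by exists u0; rewrite pF; apply: OPS_scale.
  move=> n; rewrite monicE lead_coefE pE size_scale // size_sieved // coefZ /=.
  rewrite coef_sieved // /a.
  have f0 : (n %/ k)`!%:R != 0 :> R[i] by rewrite pnatr_eq0 -lt0n fact_gt0.
  have := a0 n; rewrite mulf_eq0 invr_eq0 negb_or => /andP[_ d0].
  by rewrite mulrA divfK // divff.
- move=> u ops; have us n : u (sieved k lambda n.+1) = 0.
    have [_ orth _] := ops; have := orth n.+1 0 ltac:(by []).
    rewrite !pE -scalerAl -scalerAr mulr1 !linearZ /=.
    by move/eqP; rewrite mulf_eq0 (negPf (a0 n.+1)) mulf_eq0 (negPf (a0 0%N)) => /eqP.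
  split; first exact: pearson.
  rewrite /Phi /C /D UE TE T1E; exact: (@sieved_stieltjes _ k lambda h u hk hlambda us).
- move=> hl0; rewrite sBF; exists u0; split=> //.
  have reg : regular u0 by exists (sieved k lambda).
  have size1X : size (1 - 'X ^+ 2 : {poly R[i]}) = 3.
    by rewrite addrC size_polyDl size_polyN ?size_polyXn ?size_poly1.
  have sV : size (chebV R[i] k) = k.
    by rewrite -[k in chebV _ k](ltn_predK hk) size_chebU (ltn_predK hk).
  have V0 : chebV R[i] k != 0 by rewrite -size_poly_eq0 sV -lt0n.
  have sT : (size (chebT R[i] k) <= k.+1)%N.
    rewrite chebT_VX (leq_trans (size_polyD _ _)) // geq_max size_polyN size_chebU leqnn /=.
    by rewrite mulrC size_mulX ?sV.
  have sPhi : size Phi = k.+2.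
    rewrite /Phi UE size_mul ?scaler_eq0 ?negb_or ?h0 //; last first.
      by rewrite -size_poly_eq0 size1X.
    by rewrite size1X size_scale // sV.
  have sPsi : (size Psi <= k.+1)%N.
    rewrite /Psi UE TE size_polyN (leq_trans (size_polyD _ _)) // geq_max.
    apply/andP; split; apply: leq_trans (size_scale_leq _ _) _.
      by rewrite mulrC size_mulX ?scaler_eq0 ?negb_or ?h0 // size_scale // sV.
    exact: leq_trans (size_scale_leq _ _) sT.
  (* needed because the leading terms of Psi cancel when k (2 lambda + 1) = - 2 *)
  have Psi1 : Psi.[1] != 0.
    rewrite /Psi UE TE hornerN !(hornerD, hornerZ, hornerM, hornerX).
    rewrite chebV_at1 chebT_at1.
    have -> : - (2%:R * (1 * (h * k%:R)) + k%:R * (2%:R * lambda + 1) * (h * 1)) =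
      - (h * k%:R * (3%:R + 2%:R * lambda)) by ring.
    by rewrite oppr_eq0 !mulf_neq0 ?pnatr_eq0 -?lt0n ?(natr_add2_neq0 hlambda 2).
  have hP := pearson u0 u0s.
  have pp : pearson_pair u0 Phi Psi.
    split=> //.
    + by rewrite -size_poly_eq0 sPhi.
    + by apply: contraNneq Psi1 => ->; rewrite horner0.
    + rewrite ltnNge; apply/negP => /size1_polyC Psic.
      (* the Pearson equation at 1 forces a constant Psi to vanish *)
      have := hP 1; rewrite /fder /fmul derivC mulr0 linear0 oppr0 mulr1 Psic.
      rewrite -[_%:P]mulr1 mul_polyC linearZ /= u01 mulr1 => c0.
      by move: Psi1; rewrite Psic hornerC -c0 eqxx.
  split=> //.
    exists Phi, Psi; split=> //; rewrite /pair_class sPhi.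
    by move: (size _) sPsi => n; lia.
  move=> Phi1 Psi1' pp1; rewrite (_ : k.-1 = size Phi - 3)%N; last by rewrite sPhi; lia.
  apply: (class_ge reg hP _ pp1).
  have -> : Psi - Phi^`() = C.
    by rewrite /Psi /Phi /C UE TE (pearson_coefs k lambda h) addrC addKr.
  have -> : Phi = h *: ((1 - 'X ^+ 2) * chebV R[i] k) by rewrite /Phi UE -scalerAr.
  have -> : C = - h *: ('X * chebV R[i] k + (2%:R * k%:R * lambda) *: chebT R[i] k).
    by rewrite /C UE TE -!mul_polyC polyCN; ring.
  have kn0 : k%:R != 0 :> R[i] by rewrite pnatr_eq0 -lt0n.
  have l0 : lambda != 0 by have := hl0 0%N; rewrite mul0r oppr0.
  rewrite coprimepZl // coprimepZr ?oppr_eq0 //; apply: coprimep_pearson.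
    exact: mulf_neq0 (mulf_neq0 (two0 1%N) kn0) l0.
  have -> : k%:R + 2%:R * k%:R * lambda = k%:R * (1 + 2%:R * lambda) by ring.
  by rewrite mulf_neq0 ?(natr_add2_neq0 hlambda 0).
- move=> l0; rewrite sBF l0.
  have sU n : sieved k (0 : R[i]) n = chebU R[i] n by apply: sieved_chebU.
  split; first by exists (fun=> 1) => n; rewrite oner_neq0 scale1r sU.
  exists u0; rewrite l0 in ops0 u0s; split=> //.
  have pc : pearson_pair u0 (1 - 'X ^+ 2) (- 3%:R *: 'X).
    by apply: chebU_pearson => n; rewrite -sU.
  split=> //; first by exists (sieved k 0).
  exists (1 - 'X ^+ 2), (- 3%:R *: 'X); split=> //.
  rewrite /pair_class size_scale ?oppr_eq0 ?pnatr_eq0 // size_polyX.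
  by rewrite addrC size_polyDl size_polyN ?size_polyXn ?size_poly1.
Qed.
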